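(* Let $\mathbb{F}$ be an algebraically closed field (of arbitrary characteristic), let $q\in\mathbb{F}$ with $q\neq 0$, let $f,g\in\mathbb{F}[h]$, and let $n\ge 1$. All modules listed in (a)--(c) below are simple, and any simple $n$-dimensional $\mathcal{H}_q(f,g)$-module is isomorphic to a module of exactly one of the following types (a), (b), (c): (a) $\mathsf{A}_{q,f,g}(\lambda,\mu)/\mathbb{F}[t^{\pm1}](t^{|\lambda||\mu|}-\gamma)$, for some $\lambda\in\mathsf{S}_f$, $\mu\in\mathsf{T}_{q,g,\lambda}$ and $\gamma\in\mathbb{F}^*$ such that $n=|\lambda||\mu|$. (b) $\mathsf{B}_{q,f,g}(\lambda,\mu)/\mathbb{F}[t^{\pm1}](t^{|\lambda||\mu|}-\gamma)$, for some $\lambda\in\mathsf{S}_f$, $\mu\in\mathsf{T}_{q,g,\lambda}$ and $\gamma\in\mathbb{F}^*$ such that $n=|\lambda||\mu|$ and $\mu(i)=0$ for some $0\leq i<|\lambda||\mu|$. (c) $\mathsf{C}_{q,f,g}(\alpha)/\mathbb{F}[t]t^n$, for some $\alpha\in\mathbb{F}$ such that $\nu_\alpha(n)=0$ and $\nu_\alpha(i)\neq 0$ for all $1\leq i\leq n-1$.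
   Context: $\mathcal{H}_q(f,g)$ is the unital associative $\mathbb{F}$-algebra generated by $x,y,h$ with defining relations $hx=xf(h)$, $yh=f(h)y$, $yx-qxy=g(h)$; modules are left modules. $f^{[k]}$ is the $k$-fold compositional power of $f$ ($f^{[0]}(h)=h$). $\mathsf{S}_f$ is the set of functions $\lambda:\mathbb{Z}\to\mathbb{F}$ with $f(\lambda(i))=\lambda(i+1)$ for all $i\in\mathbb{Z}$; for $\lambda\in\mathsf{S}_f$, $|\lambda|\geq 0$ is the nonnegative generator of the subgroup $\{k\in\mathbb{Z}\mid\lambda(i)=\lambda(i+k)\ \forall i\in\mathbb{Z}\}$ of $\mathbb{Z}$. For $\lambda\in\mathsf{S}_f$, $\mathsf{T}_{q,g,\lambda}$ is the set of functions $\mu:\mathbb{Z}\to\mathbb{F}$ with $\mu(i+1)=q\mu(i)+g(\lambda(i))$ for all $i\in\mathbb{Z}$; for $\mu\in\mathsf{T}_{q,g,\lambda}$ the set $\{k\in\mathbb{Z}\mid\mu(k|\lambda|)=\mu(0)\}$ is a subgroup of $\mathbb{Z}$ (as $q\ne0$), and $|\mu|\geq 0$ denotes its nonnegative generator. For $\lambda\in\mathsf{S}_f$, $\mu\in\mathsf{T}_{q,g,\lambda}$: $\mathsf{A}_{q,f,g}(\lambda,\mu)$ is the module with underlying space the Laurent polynomials $\mathbb{F}[t^{\pm1}]$ and action $ht^i=\lambda(i)t^i$, $xt^i=t^{i+1}$, $yt^i=\mu(i)t^{i-1}$ ($i\in\mathbb{Z}$); $\mathsf{B}_{q,f,g}(\lambda,\mu)$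 is the module with underlying space $\mathbb{F}[t^{\pm1}]$ and action $ht^i=\lambda(i)t^i$, $xt^i=\mu(i+1)t^{i+1}$, $yt^i=t^{i-1}$ ($i\in\mathbb{Z}$). When $|\lambda|,|\mu|\ge1$ and $\gamma\in\mathbb{F}^*$, the subspace $\mathbb{F}[t^{\pm1}](t^{|\lambda||\mu|}-\gamma)$ (the ideal of $\mathbb{F}[t^{\pm1}]$ generated by $t^{|\lambda||\mu|}-\gamma$) is a submodule of both. For $\alpha\in\mathbb{F}$, $\nu_\alpha:\mathbb{Z}_{\geq0}\to\mathbb{F}$ is $\nu_\alpha(i)=\sum_{j=0}^{i-1}q^jg(f^{[i-1-j]}(\alpha))$, and $\mathsf{C}_{q,f,g}(\alpha)$ is the module with underlying space $\mathbb{F}[t]$ and action $ht^i=f^{[i]}(\alpha)t^i$, $xt^i=t^{i+1}$, $yt^i=\nu_\alpha(i)t^{i-1}$ for $i\geq 0$, with $yt^0=0$. When $\nu_\alpha(n)=0$, $\mathbb{F}[t]t^n$ is a submodule. *)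

(* Defs.v *)
From HB Require Import structures.
From mathcomp Require Import all_boot all_order all_algebra.
From mathcomp Require Import boolp.
From mathcomp Require Import finmap monalg.

Set Implicit Arguments.
Unset Strict Implicit.
Unset Printing Implicit Defensive.

Import Order.TTheory GRing.Theory Num.Theory.
Local Open Scope ring_scope.

Section LinearExtension.
Variables (F : fieldType) (V : lmodType F).

(* The linear map sending the basis element << k >> to phi k. *)
Definition mext (K : choiceType) (phi : K -> V) (g : {malg F[K]}) : V :=
  \sum_(k <- msupp g) g@_k *: phi k.

Lemma mextEw (K : choiceType) (phi : K -> V) (g : {malg F[K]}) (d : {fset K}) :
  (msupp g `<=` d)%fset -> mext phi g = \sum_(k <- d) g@_k *: phi k.
Proof.
move=> sub; rewrite /mext; apply: big_fset_incl => // k _ kg.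
by rewrite mcoeff_outdom // scale0r.
Qed.

Lemma mext_linear (K : choiceType) (phi : K -> V) : linear (mext phi).
Proof.
move=> c a b; pose d := (msupp a `|` msupp b)%fset.
have sa : (msupp a `<=` d)%fset by exact: fsubsetUl.
have sb : (msupp b `<=` d)%fset by exact: fsubsetUr.
have sab : (msupp (c *: a + b) `<=` d)%fset.
  apply: fsubset_trans (msuppD_le _ _) _.
  by apply: fsetUSS => //; apply: msuppZ_le.
rewrite (mextEw _ sa) (mextEw _ sb) (mextEw _ sab) scaler_sumr -big_split /=.
apply: eq_bigr => k _.
by rewrite mcoeffD mcoeffZ scalerDl scalerA.
Qed.

HB.instance Definition _ (K : choiceType) (phi : K -> V) :=
  GRing.isLinear.Build F {malg F[K]} V _ (mext phi) (mext_linear phi).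

Lemma mextU (K : choiceType) (phi : K -> V) k c :
  mext phi << c *g k >> = c *: phi k.
Proof.
rewrite (mextEw _ msuppU_le) big_seq_fset1 mcoeffUU //.
Qed.

Lemma malg_lin_ext (K : choiceType) (u v : {linear {malg F[K]} -> V}) :
  (forall k, u << k >> = v << k >>) -> u =1 v.
Proof.
move=> uv a; rewrite [a]monalgE !linear_sum; apply: eq_bigr => k _.
have -> : << a@_k *g k >> = a@_k *: << k >>.
  by apply/malgP=> j; rewrite mcoeffZ !mcoeffU mulrnAr mulr1.
by rewrite !linearZ /= uv.
Qed.

(* The linear map sending 'X^i to phi i. *)
Definition pext (phi : nat -> V) (p : {poly F}) : V :=
  \sum_(i < size p) p`_i *: phi i.

Lemma pextEw (phi : nat -> V) (p : {poly F}) n :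
  (size p <= n)%N -> pext phi p = \sum_(i < n) p`_i *: phi i.
Proof.
move=> le; rewrite /pext (big_ord_widen n (fun i => p`_i *: phi i) le).
rewrite big_mkcond /=; apply: eq_bigr => i _.
by case: ltnP => // h; rewrite nth_default // scale0r.
Qed.

Lemma pext_linear (phi : nat -> V) : linear (pext phi).
Proof.
move=> c a b; pose n := maxn (size a) (size b).
have sa : (size a <= n)%N by exact: leq_maxl.
have sb : (size b <= n)%N by exact: leq_maxr.
have sab : (size (c *: a + b)%R <= n)%N.
  apply: leq_trans (size_polyD _ _) _.
  by rewrite geq_max (leq_trans (size_scale_leq _ _)).
rewrite (pextEw _ sa) (pextEw _ sb) (pextEw _ sab) scaler_sumr -big_split /=.
apply: eq_bigr => k _.
by rewrite coefD coefZ scalerDl scalerA.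
Qed.

HB.instance Definition _ (phi : nat -> V) :=
  GRing.isLinear.Build F {poly F} V _ (pext phi) (pext_linear phi).

Lemma pextX (phi : nat -> V) k : pext phi 'X^k = phi k.
Proof.
rewrite (@pextEw phi _ k.+1) ?size_polyXn // big_ord_recr /= coefXn eqxx scale1r.
rewrite big1 ?add0r // => i _; rewrite coefXn.
by rewrite (ltn_eqF (ltn_ord i)) scale0r.
Qed.

Lemma poly_lin_ext (u v : {linear {poly F} -> V}) :
  (forall k, u 'X^k = v 'X^k) -> u =1 v.
Proof.
move=> uv p; rewrite -[p]coefK poly_def !linear_sum; apply: eq_bigr => k _.
by rewrite !linearZ /= uv.
Qed.

End LinearExtension.

Lemma malg_scalerAr (F : fieldType) (K : monomType) (c : F)
    (a b : {malg F[K]}) :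
  c *: (a * b) = a * (c *: b).
Proof.
apply/malgP=> k; rewrite mcoeffZ !(@mcoeffMlw _ _ (msupp a) (msupp b)) //;
  last exact: msuppZ_le.
rewrite mulr_sumr; apply: eq_bigr => i _; rewrite mulr_sumr.
by apply: eq_bigr => j _; rewrite mcoeffZ mulrnAr mulrCA.
Qed.

(* The free unital associative algebra on three generators: the monoid algebra
   of words over 'I_3. The letters 0, 1, 2 stand for x, y, h. *)
Definition free_alg (F : fieldType) : Type := {malg F[{fmonom 'I_3}]}.
HB.instance Definition _ (F : fieldType) := GRing.Lalgebra.on (free_alg F).

HB.instance Definition _ (F : fieldType) :=
  GRing.Lalgebra_isAlgebra.Build F (free_alg F) (@malg_scalerAr F {fmonom 'I_3}).

Section TwoSidedIdeal.
Variables (F : fieldType) (A : algType F) (S : A -> Prop).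

(* The two-sided ideal generated by S: finite sums of a * r * b with r in S. *)
Inductive ideal_gen : A -> Prop :=
| ideal_gen0 : ideal_gen 0
| ideal_genS a r b s : S r -> ideal_gen s -> ideal_gen (a * r * b + s).

Definition ideal_gen_pred : {pred A} := fun a => `[< ideal_gen a >].

Lemma ideal_genD a b : ideal_gen a -> ideal_gen b -> ideal_gen (a + b).
Proof.
elim=> [|c r d s Sr _ IH] hb; first by rewrite add0r.
by rewrite -addrA; constructor => //; apply: IH.
Qed.

Lemma ideal_genMl c a : ideal_gen a -> ideal_gen (c * a).
Proof.
elim=> [|d r e s Sr _ IH]; first by rewrite mulr0; constructor.
by rewrite mulrDr !mulrA; constructor.
Qed.

Lemma ideal_genMr c a : ideal_gen a -> ideal_gen (a * c).
Proof.
elim=> [|d r e s Sr _ IH]; first by rewrite mul0r; constructor.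
by rewrite mulrDl -!mulrA mulrA; constructor.
Qed.

Lemma ideal_gen_sub r : S r -> ideal_gen r.
Proof.
move=> Sr; have := ideal_genS 1 1 Sr ideal_gen0.
by rewrite mul1r mulr1 addr0.
Qed.

Lemma ideal_gen_zmod_closed : zmod_closed ideal_gen_pred.
Proof.
split; first by apply/asboolP; constructor.
move=> a b; rewrite !unfold_in => /asboolP ha /asboolP hb; apply/asboolP.
by apply: ideal_genD => //; rewrite -mulN1r; apply: ideal_genMl.
Qed.

HB.instance Definition _ :=
  GRing.isZmodClosed.Build A ideal_gen_pred ideal_gen_zmod_closed.

End TwoSidedIdeal.

Section QuotientAlgebra.
Variables (F : fieldType) (A : algType F) (S : A -> Prop).
Local Notation I := (ideal_gen_pred S).
Hypothesis I1 : 1 \notin I.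

(* The algebra A / (S). I1 is needed since lalgType demands a nonzero ring. *)
Definition qalg (_ : 1 \notin I) : Type := Quotient.quot I.
Local Notation Q := (qalg I1).
HB.instance Definition _ := GRing.Zmodule.on Q.

Local Open Scope quotient_scope.

Fact qalg_key : unit. Proof. exact: tt. Qed.

(* The operations are locked: unification would otherwise unfold the product of
   two concrete elements. *)
Definition qpi0 : A -> Q := locked_with qalg_key \pi_(Quotient.quot I).
Canonical qpi0_unlockable := [unlockable of qpi0].
Definition qalg_pi (a : A) : Q := qpi0 a.
Definition qalg_repr (u : Q) : A := repr (u : Quotient.quot I).

Lemma qalg_reprK u : qalg_pi (qalg_repr u) = u.
Proof. by rewrite /qalg_pi unlock; exact: reprK. Qed.

Lemma qalg_piP a b : reflect (qalg_pi a = qalg_pi b) (a - b \in I).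
Proof. by rewrite /qalg_pi unlock Quotient.idealrBE; apply: eqP. Qed.

Lemma qalg_piD a b : qalg_pi (a + b) = qalg_pi a + qalg_pi b.
Proof. by rewrite /qalg_pi unlock; exact: raddfD. Qed.
Lemma qalg_pi0 : qalg_pi 0 = 0.
Proof. by rewrite /qalg_pi unlock; exact: raddf0. Qed.

Lemma qalg_repr_pi a : qalg_repr (qalg_pi a) - a \in I.
Proof. by apply/qalg_piP; rewrite qalg_reprK. Qed.

Definition qalg_mul : Q -> Q -> Q := locked_with qalg_key
  (fun u v : Q => qalg_pi (qalg_repr u * qalg_repr v)).
Canonical qalg_mul_unlockable := [unlockable of qalg_mul].
Definition qalg_scale : F -> Q -> Q := locked_with qalg_key
  (fun c (u : Q) => qalg_pi (c *: qalg_repr u)).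
Canonical qalg_scale_unlockable := [unlockable of qalg_scale].

Lemma ideal_predMl a b : b \in I -> a * b \in I.
Proof. by move/asboolP=> h; apply/asboolP/ideal_genMl. Qed.
Lemma ideal_predMr a b : a \in I -> a * b \in I.
Proof. by move/asboolP=> h; apply/asboolP/ideal_genMr. Qed.

Lemma qalg_piM a b : qalg_pi (a * b) = qalg_mul (qalg_pi a) (qalg_pi b).
Proof.
rewrite [qalg_mul]unlock; apply/esym/qalg_piP.
rewrite -[_ - _](subrKA (a * qalg_repr (qalg_pi b))) -mulrBl -mulrBr.
by apply: rpredD; [apply: ideal_predMr|apply: ideal_predMl]; apply: qalg_repr_pi.
Qed.

Lemma qalg_piZ c a : qalg_pi (c *: a) = qalg_scale c (qalg_pi a).
Proof.
rewrite [qalg_scale]unlock; apply/esym/qalg_piP.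
by rewrite -scalerBr -mulr_algl ideal_predMl ?qalg_repr_pi.
Qed.

Lemma qalg_mulA : associative qalg_mul.
Proof.
by move=> u v w; rewrite -[u]qalg_reprK -[v]qalg_reprK -[w]qalg_reprK -!qalg_piM mulrA.
Qed.
Lemma qalg_mul1 : left_id (qalg_pi 1) qalg_mul.
Proof. by move=> u; rewrite -[u]qalg_reprK -!qalg_piM mul1r. Qed.
Lemma qalg_mulr1 : right_id (qalg_pi 1) qalg_mul.
Proof. by move=> u; rewrite -[u]qalg_reprK -!qalg_piM mulr1. Qed.
Lemma qalg_mulDl : left_distributive qalg_mul +%R.
Proof.
move=> u v w; rewrite -[u]qalg_reprK -[v]qalg_reprK -[w]qalg_reprK.
by rewrite -qalg_piD -!qalg_piM mulrDl qalg_piD.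
Qed.
Lemma qalg_mulDr : right_distributive qalg_mul +%R.
Proof.
move=> u v w; rewrite -[u]qalg_reprK -[v]qalg_reprK -[w]qalg_reprK.
by rewrite -qalg_piD -!qalg_piM mulrDr qalg_piD.
Qed.
Lemma qalg_one_neq0 : qalg_pi 1 != 0.
Proof. by rewrite -qalg_pi0; apply/eqP => /qalg_piP; rewrite subr0 (negPf I1). Qed.

HB.instance Definition _ := GRing.Zmodule_isNzRing.Build Q
  qalg_mulA qalg_mul1 qalg_mulr1 qalg_mulDl qalg_mulDr qalg_one_neq0.

Lemma qalg_scaleA a b u : qalg_scale a (qalg_scale b u) = qalg_scale (a * b) u.
Proof. by rewrite -[u]qalg_reprK -!qalg_piZ scalerA. Qed.
Lemma qalg_scale1 : left_id 1 qalg_scale.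
Proof. by move=> u; rewrite -[u]qalg_reprK -qalg_piZ scale1r. Qed.
Lemma qalg_scaleDr : right_distributive qalg_scale +%R.
Proof.
by move=> c u v; rewrite -[u]qalg_reprK -[v]qalg_reprK -qalg_piD -!qalg_piZ scalerDr qalg_piD.
Qed.
Lemma qalg_scaleDl u : {morph qalg_scale^~ u : a b / a + b}.
Proof. by move=> a b; rewrite -[u]qalg_reprK -!qalg_piZ scalerDl qalg_piD. Qed.

HB.instance Definition _ := GRing.Zmodule_isLmodule.Build F Q
  qalg_scaleA qalg_scale1 qalg_scaleDr qalg_scaleDl.

Lemma qalg_scaleAl (c : F) (u v : Q) : c *: (u * v) = (c *: u) * v.
Proof.
rewrite -[u]qalg_reprK -[v]qalg_reprK.
by rewrite -[_ * _]qalg_piM -[LHS]qalg_piZ scalerAl qalg_piM qalg_piZ.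
Qed.
HB.instance Definition _ := GRing.Lmodule_isLalgebra.Build F Q qalg_scaleAl.

Lemma qalg_scaleAr (c : F) (u v : Q) : c *: (u * v) = u * (c *: v).
Proof.
rewrite -[u]qalg_reprK -[v]qalg_reprK.
by rewrite -[_ * _]qalg_piM -[LHS]qalg_piZ scalerAr qalg_piM qalg_piZ.
Qed.
HB.instance Definition _ := GRing.Lalgebra_isAlgebra.Build F Q qalg_scaleAr.

Lemma qalg_pi_is_linear : linear qalg_pi.
Proof. by move=> c a b; rewrite qalg_piD qalg_piZ. Qed.
Lemma qalg_pi_is_monoid_morphism : monoid_morphism qalg_pi.
Proof. by split; [by [] | exact: qalg_piM]. Qed.
HB.instance Definition _ :=
  GRing.isLinear.Build F A Q _ qalg_pi qalg_pi_is_linear.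
HB.instance Definition _ :=
  GRing.isMonoidMorphism.Build A Q qalg_pi qalg_pi_is_monoid_morphism.

End QuotientAlgebra.

Section Hq.
Variables (F : fieldType) (q : F) (f g : {poly F}).

Definition gen (i : 'I_3) : free_alg F := << fmu i >>.
Definition genx : free_alg F := gen (@Ordinal 3 0 isT).
Definition geny : free_alg F := gen (@Ordinal 3 1 isT).
Definition genh : free_alg F := gen (@Ordinal 3 2 isT).

Definition relator (r : free_alg F) : Prop :=
  [\/ r = genh * genx - genx * horner_alg genh f,
      r = geny * genh - horner_alg genh f * geny
    | r = geny * genx - q *: (genx * geny) - horner_alg genh g].

Definition Hideal : zmodClosed (free_alg F) := ideal_gen_pred relator.

Section Representation.
Variable V : lmodType F.

(* p(T) v for an operator T. *)
Definition peval (p : {poly F}) (T : V -> V) (v : V) : V :=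
  \sum_(i < size p) p`_i *: iter i T v.

Lemma peval_linear p (T : {linear V -> V}) : linear (peval p T).
Proof.
move=> c u v; rewrite /peval scaler_sumr -big_split /=.
apply: eq_bigr => i _; rewrite !scalerA [c * _]mulrC -scalerA -scalerDr.
by congr (_ *: _); elim: (i : nat) => [//|n IH]; rewrite !iterS IH linearP.
Qed.
HB.instance Definition _ p (T : {linear V -> V}) :=
  GRing.isLinear.Build F V V _ (peval p T) (peval_linear p T).

Lemma peval_eigen p (T : {linear V -> V}) c v :
  T v = c *: v -> peval p T v = p.[c] *: v.
Proof.
move=> Tv; rewrite horner_coef scaler_suml; apply: eq_bigr => i _.
rewrite -scalerA; congr (_ *: _).
elim: (i : nat) => [|n IH]; first by rewrite scale1r.
by rewrite iterS IH linearZ /= Tv scalerA -exprSr.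
Qed.

Record hrep := HRep {
  opx : {linear V -> V};
  opy : {linear V -> V};
  oph : {linear V -> V};
  hrep_hx : forall v, oph (opx v) = opx (peval f oph v);
  hrep_yh : forall v, opy (oph v) = peval f oph (opy v);
  hrep_yx : forall v, opy (opx v) - q *: opx (opy v) = peval g oph v
}.

Variable r : hrep.

Definition op_gen (i : 'I_3) : {linear V -> V} :=
  match val i with 0%N => opx r | 1%N => opy r | _ => oph r end.

Definition word_act (w : seq 'I_3) (v : V) : V :=
  foldr (fun i u => op_gen i u) v w.

Definition free_act (a : free_alg F) (v : V) : V :=
  mext (fun w : {fmonom 'I_3} => word_act w v) a.

Lemma word_act_linear w : linear (word_act w).
Proof.
by move=> c u v; elim: w => [//|i w IH] /=; rewrite IH linearP.
Qed.
HB.instance Definition _ w :=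
  GRing.isLinear.Build F V V _ (word_act w) (word_act_linear w).

Lemma free_act_linear a : linear (free_act a).
Proof.
move=> c u v; rewrite /free_act /mext scaler_sumr -big_split /=.
by apply: eq_bigr => w _; rewrite linearP scalerDr !scalerA mulrC.
Qed.
HB.instance Definition _ a :=
  GRing.isLinear.Build F V V _ (free_act a) (free_act_linear a).

Lemma free_actDl a b v : free_act (a + b) v = free_act a v + free_act b v.
Proof. exact: linearD. Qed.
Lemma free_actNl a v : free_act (- a) v = - free_act a v.
Proof. exact: linearN. Qed.
Lemma free_act0l v : free_act 0 v = 0.
Proof. exact: linear0. Qed.
Lemma free_actZl c a v : free_act (c *: a) v = c *: free_act a v.
Proof. exact: linearZ. Qed.
Lemma free_act_suml (I : Type) (s : seq I) (a : I -> free_alg F) v :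
  free_act (\sum_(i <- s) a i) v = \sum_(i <- s) free_act (a i) v.
Proof. exact: linear_sum. Qed.

Lemma free_act1 v : free_act 1 v = v.
Proof. by rewrite /free_act mextU scale1r fm1. Qed.

Lemma free_actM a b v : free_act (a * b) v = free_act a (free_act b v).
Proof.
rewrite malgME free_act_suml {2}/free_act /mext; apply: eq_bigr => k _.
rewrite free_act_suml {2}/free_act /mext linear_sum scaler_sumr.
apply: eq_bigr => l _; rewrite linearZ /= scalerA /free_act mextU.
by rewrite fmM /word_act foldr_cat.
Qed.

Lemma free_act_gen i v : free_act (gen i) v = op_gen i v.
Proof. by rewrite /free_act mextU scale1r fmU. Qed.

Lemma free_act_horner p v :
  free_act (horner_alg genh p) v = peval p (oph r) v.
Proof.
rewrite -[p in LHS]coefK poly_def linear_sum /= free_act_suml.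
apply: eq_bigr => i _.
rewrite -mul_polyC rmorphM /= horner_algC mulr_algl free_actZl; congr (_ *: _).
rewrite rmorphXn /= horner_algX.
elim: (i : nat) v => [|n IH] v; first by rewrite expr0 free_act1.
by rewrite exprS free_actM IH free_act_gen.
Qed.

Lemma free_act_relator s v : relator s -> free_act s v = 0.
Proof.
case=> ->; rewrite !(free_actDl, free_actNl, free_actZl, free_actM)
  !(free_act_horner, free_act_gen) /op_gen /=; apply/eqP.
- by rewrite subr_eq0 hrep_hx.
- by rewrite subr_eq0 hrep_yh.
- by rewrite hrep_yx subrr.
Qed.

Lemma free_act_ideal a v : a \in Hideal -> free_act a v = 0.
Proof.
move/asboolP; elim=> [|c s d b Ss _ IH]; first exact: free_act0l.
by rewrite free_actDl IH addr0 !free_actM (free_act_relator _ Ss) linear0.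
Qed.

End Representation.

Section C.
Variable alpha : F.

(* f^[k](alpha) *)
Definition fiter (k : nat) : F := iter k (fun u => f.[u]) alpha.

Definition nu (i : nat) : F := \sum_(j < i) q ^+ j * g.[fiter (i - 1 - j)].

Definition C_h : {poly F} -> {poly F} := pext (fun i => fiter i *: 'X^i).
Definition C_x : {poly F} -> {poly F} := pext (fun i => 'X^(i.+1)).
Definition C_y : {poly F} -> {poly F} :=
  pext (fun i => if i is j.+1 then nu i *: 'X^j else 0).
HB.instance Definition _ := GRing.Linear.on C_h.
HB.instance Definition _ := GRing.Linear.on C_x.
HB.instance Definition _ := GRing.Linear.on C_y.

Lemma nu0 : nu 0 = 0. Proof. by rewrite /nu big_ord0. Qed.

Lemma nuS i : nu i.+1 = q * nu i + g.[fiter i].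
Proof.
rewrite /nu big_ord_recl expr0 mul1r subn1 subn0 addrC; congr (_ + _).
rewrite mulr_sumr; apply: eq_bigr => j _.
by rewrite /= /bump /= add1n exprS -mulrA subnS subn1 -subnS -subn1 -subnDA.
Qed.

Lemma C_hX k : C_h 'X^k = fiter k *: 'X^k. Proof. exact: pextX. Qed.
Lemma C_xX k : C_x 'X^k = 'X^(k.+1). Proof. exact: pextX. Qed.
Lemma C_y0 : C_y 1 = 0. Proof. by rewrite -(expr0 'X) /C_y pextX. Qed.
Lemma C_yX k : C_y 'X^(k.+1) = nu k.+1 *: 'X^k. Proof. exact: pextX. Qed.

Lemma C_hx v : C_h (C_x v) = C_x (peval f C_h v).
Proof.
apply: (poly_lin_ext (u := C_h \o C_x) (v := C_x \o peval f C_h)) => k /=.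
by rewrite (peval_eigen f (C_hX k)) linearZ /= !C_xX C_hX.
Qed.

Lemma C_yh v : C_y (C_h v) = peval f C_h (C_y v).
Proof.
apply: (poly_lin_ext (u := C_y \o C_h) (v := peval f C_h \o C_y)) => k /=.
rewrite C_hX linearZ /=; case: k => [|k].
  by rewrite expr0 C_y0 scaler0 linear0.
by rewrite C_yX [peval _ _ _]linearZ /= (peval_eigen f (C_hX k)) !scalerA mulrC.
Qed.

Lemma C_yx v : C_y (C_x v) - q *: C_x (C_y v) = peval g C_h v.
Proof.
apply: (poly_lin_ext (u := (C_y \o C_x) \- (q \*: (C_x \o C_y)))
  (v := peval g C_h)) => k /=.
rewrite (peval_eigen g (C_hX k)) C_xX C_yX nuS scalerDl; case: k => [|k].
  by rewrite expr0 C_y0 linear0 nu0 mulr0 scaler0 subr0 scale0r add0r.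
by rewrite C_yX [C_x _]linearZ /= C_xX scalerA addrAC subrr add0r.
Qed.

Definition C_rep : hrep {poly F} := HRep C_hx C_yh C_yx.
End C.

Lemma Hideal1 : 1 \notin Hideal.
Proof.
apply/negP => /(free_act_ideal (C_rep 0) 1); rewrite free_act1.
by apply/eqP; exact: oner_neq0.
Qed.

Definition Hq : algType F := qalg Hideal1.
Definition Hpi : {lrmorphism free_alg F -> Hq} := @qalg_pi _ _ _ Hideal1.

Definition Hx : Hq := Hpi genx.
Definition Hy : Hq := Hpi geny.
Definition Hh : Hq := Hpi genh.

Lemma Hpi_relator s : relator s -> Hpi s = 0.
Proof.
move=> Ss; rewrite -(rmorph0 Hpi); apply/qalg_piP; rewrite subr0.
by apply/asboolP/ideal_gen_sub.
Qed.

Lemma Hpi_horner p : Hpi (horner_alg genh p) = horner_alg Hh p.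
Proof.
elim/poly_ind: p => [|p c IH]; first by rewrite !raddf0.
rewrite !rmorphD !rmorphM /= !horner_algC !horner_algX IH.
by rewrite linearZ /= rmorph1.
Qed.

Lemma Hrel_hx : Hh * Hx = Hx * horner_alg Hh f.
Proof.
apply/eqP; rewrite -subr_eq0 -Hpi_horner -!rmorphM -rmorphB /=.
by apply/eqP/Hpi_relator; constructor 1.
Qed.
Lemma Hrel_yh : Hy * Hh = horner_alg Hh f * Hy.
Proof.
apply/eqP; rewrite -subr_eq0 -Hpi_horner -!rmorphM -rmorphB /=.
by apply/eqP/Hpi_relator; constructor 2.
Qed.
Lemma Hrel_yx : Hy * Hx - q *: (Hx * Hy) = horner_alg Hh g.
Proof.
apply/eqP; rewrite -subr_eq0 -Hpi_horner -!rmorphM -linearZ -!rmorphB /=.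
by apply/eqP/Hpi_relator; constructor 3.
Qed.

(* The left Hq-module carried by V in which x, y, h act by the operators of r;
   see rep_scale_x, rep_scale_y, rep_scale_h and rep_scale_alg below. *)
Definition rep_module (V : lmodType F) (r : hrep V) : Type := V.
HB.instance Definition _ (V : lmodType F) (r : hrep V) :=
  GRing.Zmodule.on (rep_module r).

Section RepModule.
Variables (V : lmodType F) (r : hrep V).
Local Notation rep_module := (rep_module r).

Definition Hact (u : Hq) (v : rep_module) : rep_module :=
  free_act r (qalg_repr u) v.

Lemma Hact_pi a v : Hact (Hpi a) v = free_act r a v.
Proof.
apply/eqP; rewrite -subr_eq0 /Hact -free_actNl -free_actDl.
by apply/eqP/free_act_ideal/qalg_repr_pi.
Qed.

Lemma HactA a b v : Hact a (Hact b v) = Hact (a * b) v.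
Proof. by rewrite -[a]qalg_reprK -[b]qalg_reprK -rmorphM !Hact_pi free_actM. Qed.
Lemma Hact1 : left_id 1 Hact.
Proof. by move=> v; rewrite -(rmorph1 Hpi) Hact_pi free_act1. Qed.
Lemma HactDr : right_distributive Hact +%R.
Proof. by move=> a u v; rewrite /Hact; apply: (linearD (free_act r _)). Qed.
Lemma HactDl v : {morph Hact^~ v : a b / a + b}.
Proof.
by move=> a b; rewrite -[a]qalg_reprK -[b]qalg_reprK -rmorphD !Hact_pi free_actDl.
Qed.
HB.instance Definition _ := GRing.Zmodule_isLmodule.Build Hq rep_module
  HactA Hact1 HactDr HactDl.

Lemma rep_scaleE (a : free_alg F) (v : rep_module) :
  Hpi a *: v = free_act r a v.
Proof. exact: Hact_pi. Qed.
Lemma rep_scale_x (v : rep_module) : Hx *: v = opx r v.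
Proof. by rewrite rep_scaleE free_act_gen. Qed.
Lemma rep_scale_y (v : rep_module) : Hy *: v = opy r v.
Proof. by rewrite rep_scaleE free_act_gen. Qed.
Lemma rep_scale_h (v : rep_module) : Hh *: v = oph r v.
Proof. by rewrite rep_scaleE free_act_gen. Qed.
Lemma rep_scale_alg (c : F) (v : rep_module) : c%:A *: v = c *: (v : V).
Proof.
have -> : (c%:A : Hq) = Hpi c%:A by rewrite linearZ /= rmorph1.
by rewrite rep_scaleE free_actZl free_act1.
Qed.

Lemma rep_submod_closed (S : {pred rep_module}) :
  0 \in S ->
  (forall (c : F) (u v : V), u \in S -> v \in S -> c *: u + v \in S) ->
  (forall v : V, v \in S -> opx r v \in S) ->
  (forall v : V, v \in S -> opy r v \in S) ->
  (forall v : V, v \in S -> oph r v \in S) ->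
  submod_closed S.
Proof.
move=> S0 SD Sx Sy Sh; split=> // a u v Su Sv.
have Sw w (z : V) : z \in S -> word_act r w z \in S.
  move=> Sz; elim: w => [//|i w IH] /=; rewrite /op_gen.
  by case: (val i) => [|[|?]]; [exact: Sx|exact: Sy|exact: Sh].
suff Sa : a *: u \in S.
  by have := SD 1 (a *: u) v Sa Sv; rewrite scale1r.
rewrite -[a]qalg_reprK rep_scaleE /free_act /mext.
elim/big_rec: _ => [|k z _ Sz]; first exact: S0.
exact: SD (Sw _ _ Su) Sz.
Qed.
End RepModule.
End Hq.

Section Modules.
Variable R : pzRingType.

(* submodClosed predicates are boolean; over boolp every Prop-valued submodule
   is one of them. *)
Definition simple_module (M : lmodType R) : Prop :=
  (exists v : M, v != 0) /\
  forall N : submodClosed M,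
    (forall v : M, v \in N -> v = 0) \/ (forall v : M, v \in N).

Definition isomorphic (M M' : lmodType R) : Prop :=
  exists phi : {linear M -> M'}, bijective phi.

Section Quotient.
Variables (M : lmodType R) (N : submodClosed M).

(* submodClosed does not inherit from zmodClosed, which Quotient.quot needs. *)
Definition submod_pred : {pred M} := N.
HB.instance Definition _ := GRing.isZmodClosed.Build M submod_pred
  (GRing.submod_closedB (submodClosedP N)).

Definition quot_module : Type := Quotient.quot submod_pred.
HB.instance Definition _ := GRing.Zmodule.on quot_module.

Local Open Scope quotient_scope.

Definition qpi (v : M) : quot_module := \pi_(Quotient.quot submod_pred) v.
Definition qrepr (v : quot_module) : M := repr (v : Quotient.quot submod_pred).

Lemma qreprK v : qpi (qrepr v) = v. Proof. exact: reprK. Qed.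
Lemma qpiP u v : reflect (qpi u = qpi v) (u - v \in N).
Proof. by rewrite -[_ \in N]/(_ \in submod_pred) Quotient.idealrBE; apply: eqP. Qed.
Lemma qpiD u v : qpi (u + v) = qpi u + qpi v. Proof. exact: raddfD. Qed.

Definition qscale (a : R) (v : quot_module) : quot_module := qpi (a *: qrepr v).

Lemma qpiZ a v : qpi (a *: v) = qscale a (qpi v).
Proof.
by apply/esym/qpiP; rewrite -scalerBr rpredZ //; apply/qpiP; rewrite qreprK.
Qed.

Lemma qscaleA a b v : qscale a (qscale b v) = qscale (a * b) v.
Proof. by rewrite -[v]qreprK -!qpiZ scalerA. Qed.
Lemma qscale1 : left_id 1 qscale.
Proof. by move=> v; rewrite -[v]qreprK -qpiZ scale1r. Qed.
Lemma qscaleDr : right_distributive qscale +%R.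
Proof.
by move=> c u v; rewrite -[u]qreprK -[v]qreprK -qpiD -!qpiZ scalerDr qpiD.
Qed.
Lemma qscaleDl v : {morph qscale^~ v : a b / a + b}.
Proof. by move=> a b; rewrite -[v]qreprK -!qpiZ scalerDl qpiD. Qed.

HB.instance Definition _ := GRing.Zmodule_isLmodule.Build R quot_module
  qscaleA qscale1 qscaleDr qscaleDl.

Lemma qpi_is_linear : linear qpi.
Proof. by move=> a u v; rewrite qpiD qpiZ. Qed.
HB.instance Definition _ :=
  GRing.isLinear.Build R M quot_module _ qpi qpi_is_linear.
End Quotient.
End Modules.

Section Restriction.
Variables (F : fieldType) (A : algType F) (M : lmodType A).

Definition restrict_scalars : Type := M.
HB.instance Definition _ := GRing.Zmodule.on restrict_scalars.

Definition rscale (c : F) (v : restrict_scalars) : restrict_scalars :=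
  (c%:A : A) *: (v : M).

Lemma rscaleA a b v : rscale a (rscale b v) = rscale (a * b) v.
Proof. by rewrite /rscale scalerA mulr_algl scalerA. Qed.
Lemma rscale1 : left_id 1 rscale.
Proof. by move=> v; rewrite /rscale scale1r scale1r. Qed.
Lemma rscaleDr : right_distributive rscale +%R.
Proof. by move=> a u v; rewrite /rscale scalerDr. Qed.
Lemma rscaleDl v : {morph rscale^~ v : a b / a + b}.
Proof. by move=> a b; rewrite /rscale !scalerDl. Qed.

HB.instance Definition _ := GRing.Zmodule_isLmodule.Build F restrict_scalars
  rscaleA rscale1 rscaleDr rscaleDl.

Definition has_dim (n : nat) : Prop := isomorphic restrict_scalars 'rV[F]_n.
End Restriction.

Definition is_subgroup_gen (P : int -> Prop) (d : nat) : Prop :=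
  forall k : int, P k <-> (d %| k)%Z.

(* The nonnegative generator of the subgroup P of the integers; by
   subgroup_genP the default 0 is never used when P is a subgroup. *)
Definition subgroup_gen (P : int -> Prop) : nat :=
  if pselect (exists d, is_subgroup_gen P d) is left e then sval (cid e) else 0%N.

Lemma subgroup_gen_unique P d e :
  is_subgroup_gen P d -> is_subgroup_gen P e -> d = e.
Proof.
move=> hd he; apply/eqP; rewrite eqn_dvd.
have /he : P d by apply/hd; rewrite dvdzz.
have /hd : P e by apply/he; rewrite dvdzz.
by rewrite !dvdzE /= => -> ->.
Qed.

Lemma subgroup_genP P :
  P 0 -> (forall a b, P a -> P b -> P (a - b)) ->
  is_subgroup_gen P (subgroup_gen P).
Proof.
move=> P0 PB; rewrite /subgroup_gen; case: pselect => [e|[]].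
  by case: (cid e).
have PN a : P a -> P (- a) by move=> Pa; rewrite -sub0r; exact: PB.
have PD a b : P a -> P b -> P (a + b).
  by move=> Pa Pb; rewrite -[b]opprK; apply: PB => //; apply: PN.
have PM a (k : int) : P a -> P (k * a).
  move=> Pa; elim/int_rect: k => [|n IH|n IH]; first by rewrite mul0r.
    by rewrite -addn1 PoszD mulrDl mul1r; apply: PD.
  by rewrite -addn1 PoszD opprD mulrDl mulN1r; apply: PB.
have [ex|nex] := pselect (exists d : nat, (0 < d)%N && `[< P d >]).
  case: (ex_minnP ex) => d /andP[d0 /asboolP Pd] dmin; exists d => k; split.
    move=> Pk; apply/dvdz_mod0P; have Pr : P (k %% d)%Z.
      by rewrite /modz; apply: PB => //; apply: PM.
    have dn0 : d%:Z != 0 by rewrite -lt0n.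
    have m0 := modz_ge0 k dn0; have md := ltz_pmod k (d0 : 0 < d%:Z).
    case: (k %% d)%Z Pr m0 md => [m|m] Pm m0 md; last by [].
    move: md; rewrite ltz_nat; case: m Pm {m0} => // m Pm md.
    have := dmin m.+1; rewrite (asboolT Pm) => /(_ isT).
    by rewrite leqNgt md.
  by case/dvdzP => m ->; apply: PM.
exists 0%N => k; rewrite dvd0z; split=> [Pk|/eqP -> //].
apply/negPn/negP => k0; apply: nex; exists `|k|%N; rewrite absz_gt0 k0 /=.
apply/asboolP; case: (intP k) Pk k0 => // m Pk _; rewrite abszN.
by rewrite -[X in P X]opprK; apply: PN.
Qed.

Section Weights.
Variables (F : fieldType) (q : F) (f g : {poly F}).

(* S_f, and T_(q, g, lam) for lam in S_f *)
Record Sset := MkS {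
  S_fun :> int -> F;
  S_funP : forall i : int, f.[S_fun i] = S_fun (i + 1)
}.

Record Tset (lam : Sset) := MkT {
  T_fun :> int -> F;
  T_funP : forall i : int, T_fun (i + 1) = q * T_fun i + g.[lam i]
}.

(* |lam| and |mu| *)
Definition S_abs (lam : Sset) : nat :=
  subgroup_gen (fun k : int => forall i : int, lam i = lam (i + k)).

Definition T_abs (lam : Sset) (mu : Tset lam) : nat :=
  subgroup_gen (fun k : int => mu (k * (S_abs lam)%:Z) = mu 0).

Lemma S_absP (lam : Sset) (k : int) :
  (forall i : int, lam i = lam (i + k)) <-> (S_abs lam %| k)%Z.
Proof.
apply: (subgroup_genP (P := fun k => forall i, lam i = lam (i + k))) => {k}.
  by move=> i; rewrite addr0.
move=> a b Pa Pb i; rewrite (Pb (i + (a - b))) -addrA subrK; exact: Pa.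
Qed.

Lemma T_shift (lam : Sset) (mu : Tset lam) (k : int) : q != 0 ->
  mu (k * (S_abs lam)%:Z) = mu 0 ->
  forall i : int, mu (i + k * (S_abs lam)%:Z) = mu i.
Proof.
move=> q0; set s := k * _ => m0.
have lamP j : lam j = lam (j + s) by apply/S_absP: j; rewrite dvdz_mull ?dvdzz.
have step j : mu (j + s) = mu j <-> mu (j + 1 + s) = mu (j + 1).
  rewrite addrAC !T_funP -lamP; split=> [->//|/addIr].
  by move/(mulfI q0).
elim/int_rect => [|n IH|n IH]; first by rewrite add0r.
  by rewrite -addn1 PoszD -step.
by apply/step; rewrite -addn1 PoszD opprD addrNK.
Qed.

Lemma T_absP (lam : Sset) (mu : Tset lam) (k : int) : q != 0 ->
  mu (k * (S_abs lam)%:Z) = mu 0 <-> (T_abs mu %| k)%Z.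
Proof.
move=> q0; apply: (subgroup_genP
  (P := fun k => mu (k * (S_abs lam)%:Z) = mu 0)) => {k}.
  by rewrite mul0r.
move=> a b Pa Pb; rewrite mulrBl.
by rewrite -[LHS](T_shift q0 Pb) subrK.
Qed.

Lemma S_period (lam : Sset) (mu : Tset lam) (i : int) :
  lam (i + (S_abs lam * T_abs mu)%N) = lam i.
Proof.
by apply/esym; move: i; apply/S_absP; rewrite PoszM dvdz_mulr ?dvdzz.
Qed.

Lemma T_period (lam : Sset) (mu : Tset lam) (i : int) : q != 0 ->
  mu (i + (S_abs lam * T_abs mu)%N) = mu i.
Proof.
by move=> q0; rewrite PoszM mulrC T_shift // T_absP ?dvdzz.
Qed.

End Weights.

Section Laurent.
Variable F : fieldType.

(* Laurent polynomials as finitely supported functions int -> F; {malg F[int]}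
   has no ring structure because monomType excludes monoids with nontrivial
   units, so the product is given as the bilinear extension of
   t^i * t^j = t^(i + j). *)
Definition laurent : Type := {malg F[int]}.
HB.instance Definition _ := GRing.Lmodule.on laurent.

Definition tpow (i : int) : laurent := << i >>.

Definition laurent_mul (p r : laurent) : laurent :=
  mext (fun i => mext (fun j => tpow (i + j)) r) p.

Definition laurent_mulr (r p : laurent) : laurent := laurent_mul p r.

Lemma laurent_mulr_linear r : linear (laurent_mulr r).
Proof. by move=> c a b; rewrite /laurent_mulr /laurent_mul linearP. Qed.
HB.instance Definition _ r := GRing.isLinear.Build F laurent laurent _
  (laurent_mulr r) (laurent_mulr_linear r).

(* The ideal F[t, t^-1] p. *)
Definition laurent_ideal_mem (p : laurent) : {pred laurent} :=
  fun v => `[< exists r, v = laurent_mul r p >].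

Lemma laurent_mul_tpow i j : laurent_mul (tpow i) (tpow j) = tpow (i + j).
Proof. by rewrite /laurent_mul /tpow !mextU !scale1r. Qed.

Lemma laurent_mulBr i p r :
  laurent_mul (tpow i) (p - r) = laurent_mul (tpow i) p - laurent_mul (tpow i) r.
Proof. by rewrite /laurent_mul /tpow !mextU !scale1r linearB. Qed.

Lemma laurent_mulZr i c p :
  laurent_mul (tpow i) (c *: p) = c *: laurent_mul (tpow i) p.
Proof. by rewrite /laurent_mul /tpow !mextU !scale1r linearZ. Qed.

(* t^N - gam *)
Definition laurent_binom (N : nat) (gam : F) : laurent := tpow N%:Z - gam *: tpow 0.

Lemma tpow_mul_binom i N gam :
  laurent_mul (tpow i) (laurent_binom N gam) = tpow (i + N%:Z) - gam *: tpow i.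
Proof.
by rewrite laurent_mulBr laurent_mulZr !laurent_mul_tpow addr0.
Qed.

Lemma wshift_ideal (W : {linear laurent -> laurent}) (phi : int -> F) d N gam v :
  (forall i, W (tpow i) = phi i *: tpow (i + d)) ->
  (forall i, phi (i + N%:Z) = phi i) ->
  v \in laurent_ideal_mem (laurent_binom N gam) ->
  W v \in laurent_ideal_mem (laurent_binom N gam).
Proof.
move=> WE per /asboolP[r ->]; apply/asboolP; exists (W r).
apply: (malg_lin_ext (u := W \o laurent_mulr (laurent_binom N gam))
  (v := laurent_mulr (laurent_binom N gam) \o W)) => i /=.
rewrite -/(tpow i) WE [in RHS]linearZ /= /laurent_mulr.
rewrite !tpow_mul_binom linearB linearZ /= !WE per scalerBr.
by rewrite !scalerA mulrC addrAC.
Qed.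

End Laurent.

Section AB.
Variables (F : fieldType) (q : F) (f g : {poly F}).
Variables (lam : Sset f) (mu : Tset q g lam).

Local Notation t := (@tpow F).

Definition AB_h : laurent F -> laurent F := mext (fun i => lam i *: t i).
Definition A_x : laurent F -> laurent F := mext (fun i => t (i + 1)).
Definition A_y : laurent F -> laurent F := mext (fun i => mu i *: t (i - 1)).
Definition B_x : laurent F -> laurent F :=
  mext (fun i => mu (i + 1) *: t (i + 1)).
Definition B_y : laurent F -> laurent F := mext (fun i => t (i - 1)).
HB.instance Definition _ := GRing.Linear.on AB_h.
HB.instance Definition _ := GRing.Linear.on A_x.
HB.instance Definition _ := GRing.Linear.on A_y.
HB.instance Definition _ := GRing.Linear.on B_x.
HB.instance Definition _ := GRing.Linear.on B_y.

Lemma AB_hT i : AB_h (t i) = lam i *: t i.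
Proof. by rewrite /AB_h mextU scale1r. Qed.
Lemma A_xT i : A_x (t i) = t (i + 1).
Proof. by rewrite /A_x mextU scale1r. Qed.
Lemma A_yT i : A_y (t i) = mu i *: t (i - 1).
Proof. by rewrite /A_y mextU scale1r. Qed.
Lemma B_xT i : B_x (t i) = mu (i + 1) *: t (i + 1).
Proof. by rewrite /B_x mextU scale1r. Qed.
Lemma B_yT i : B_y (t i) = t (i - 1).
Proof. by rewrite /B_y mextU scale1r. Qed.

Lemma A_hx v : AB_h (A_x v) = A_x (peval f AB_h v).
Proof.
apply: (malg_lin_ext (u := AB_h \o A_x) (v := A_x \o peval f AB_h)) => i /=.
rewrite -/(t i) (peval_eigen f (AB_hT i)) linearZ /= !A_xT AB_hT.
by rewrite (S_funP lam).
Qed.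
Lemma A_yh v : A_y (AB_h v) = peval f AB_h (A_y v).
Proof.
apply: (malg_lin_ext (u := A_y \o AB_h) (v := peval f AB_h \o A_y)) => i /=.
rewrite -/(t i) AB_hT [LHS]linearZ /= A_yT [RHS]linearZ /=.
by rewrite (peval_eigen f (AB_hT _)) (S_funP lam) subrK !scalerA mulrC.
Qed.
Lemma A_yx v : A_y (A_x v) - q *: A_x (A_y v) = peval g AB_h v.
Proof.
apply: (malg_lin_ext (u := (A_y \o A_x) \- (q \*: (A_x \o A_y)))
  (v := peval g AB_h)) => i /=.
rewrite -/(t i) (peval_eigen g (AB_hT i)) A_xT !A_yT [A_x _]linearZ /= A_xT.
by rewrite subrK addrK scalerA -scalerBl T_funP addrAC subrr add0r.
Qed.
Definition A_rep : hrep q f g (laurent F) := HRep A_hx A_yh A_yx.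

Lemma B_hx v : AB_h (B_x v) = B_x (peval f AB_h v).
Proof.
apply: (malg_lin_ext (u := AB_h \o B_x) (v := B_x \o peval f AB_h)) => i /=.
rewrite -/(t i) (peval_eigen f (AB_hT i)) [RHS]linearZ /= !B_xT.
by rewrite [LHS]linearZ /= AB_hT (S_funP lam) !scalerA mulrC.
Qed.
Lemma B_yh v : B_y (AB_h v) = peval f AB_h (B_y v).
Proof.
apply: (malg_lin_ext (u := B_y \o AB_h) (v := peval f AB_h \o B_y)) => i /=.
rewrite -/(t i) AB_hT [LHS]linearZ /= B_yT.
by rewrite (peval_eigen f (AB_hT _)) (S_funP lam) subrK.
Qed.
Lemma B_yx v : B_y (B_x v) - q *: B_x (B_y v) = peval g AB_h v.
Proof.
apply: (malg_lin_ext (u := (B_y \o B_x) \- (q \*: (B_x \o B_y)))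
  (v := peval g AB_h)) => i /=.
rewrite -/(t i) (peval_eigen g (AB_hT i)) B_xT B_yT [B_y _]linearZ /= B_yT B_xT.
by rewrite subrK addrK scalerA -scalerBl T_funP addrAC subrr add0r.
Qed.
Definition B_rep : hrep q f g (laurent F) := HRep B_hx B_yh B_yx.

Definition A_module : lmodType (Hq q f g) := rep_module A_rep.
Definition B_module : lmodType (Hq q f g) := rep_module B_rep.

Hypothesis q0 : q != 0.
Variable gam : F.

Definition AB_ideal : {pred laurent F} :=
  laurent_ideal_mem (laurent_binom (S_abs lam * T_abs mu) gam).

Lemma AB_ideal0 : 0 \in AB_ideal.
Proof.
by apply/asboolP; exists 0; rewrite -/(laurent_mulr _ _) linear0.
Qed.
Lemma AB_idealD (c : F) u v :
  u \in AB_ideal -> v \in AB_ideal -> c *: u + v \in AB_ideal.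
Proof.
move=> /asboolP[r ->] /asboolP[s ->]; apply/asboolP; exists (c *: r + s).
by rewrite -!/(laurent_mulr _ _) linearP.
Qed.

Let per_lam i := S_period mu i.
Let per_mu i := T_period mu i q0.

Lemma AB_ideal_h v : v \in AB_ideal -> AB_h v \in AB_ideal.
Proof.
apply: (wshift_ideal (W := AB_h) (phi := lam) (d := 0)) => [i|i].
  by rewrite /= addr0 AB_hT.
exact: per_lam.
Qed.
Lemma A_ideal_x v : v \in AB_ideal -> A_x v \in AB_ideal.
Proof.
apply: (wshift_ideal (W := A_x) (phi := fun=> 1) (d := 1)) => // i.
by rewrite /= A_xT scale1r.
Qed.
Lemma A_ideal_y v : v \in AB_ideal -> A_y v \in AB_ideal.
Proof.
apply: (wshift_ideal (W := A_y) (phi := mu) (d := -1)) => i.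
  exact: A_yT.
exact: per_mu.
Qed.
Lemma B_ideal_x v : v \in AB_ideal -> B_x v \in AB_ideal.
Proof.
apply: (wshift_ideal (W := B_x) (phi := fun i => mu (i + 1)) (d := 1)) => i.
  exact: B_xT.
by rewrite addrAC per_mu.
Qed.
Lemma B_ideal_y v : v \in AB_ideal -> B_y v \in AB_ideal.
Proof.
apply: (wshift_ideal (W := B_y) (phi := fun=> 1) (d := -1)) => // i.
by rewrite /= B_yT scale1r.
Qed.

Definition A_ideal : {pred A_module} := AB_ideal.
Lemma A_ideal_submod : submod_closed A_ideal.
Proof.
exact: (rep_submod_closed (r := A_rep) AB_ideal0 AB_idealD A_ideal_x A_ideal_y
  AB_ideal_h).
Qed.
Definition A_submod : submodClosed A_module :=
  HB.pack A_ideal (GRing.isSubmodClosed.Build _ A_module A_ideal A_ideal_submod).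

Definition B_ideal : {pred B_module} := AB_ideal.
Lemma B_ideal_submod : submod_closed B_ideal.
Proof.
exact: (rep_submod_closed (r := B_rep) AB_ideal0 AB_idealD B_ideal_x B_ideal_y
  AB_ideal_h).
Qed.
Definition B_submod : submodClosed B_module :=
  HB.pack B_ideal (GRing.isSubmodClosed.Build _ B_module B_ideal B_ideal_submod).

Definition A_quot : lmodType (Hq q f g) := quot_module A_submod.
Definition B_quot : lmodType (Hq q f g) := quot_module B_submod.
End AB.

Section CQ.
Variables (F : fieldType) (q : F) (f g : {poly F}) (alpha : F) (n : nat).

Definition C_module : lmodType (Hq q f g) := rep_module (C_rep q f g alpha).

Hypothesis nun : nu q f g alpha n = 0.

Definition C_ideal : {pred C_module} :=
  fun v : {poly F} => `[< exists r : {poly F}, v = r * 'X^n >].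

Lemma C_ideal_ext (W : {linear {poly F} -> {poly F}}) (v : {poly F}) :
  (forall i, W 'X^(i + n) \in C_ideal) -> v \in C_ideal -> W v \in C_ideal.
Proof.
move=> WX /asboolP[r ->].
rewrite -[r]coefK poly_def mulr_suml linear_sum.
elim/big_rec: _ => [|i x _ /asboolP[s ->]].
  by apply/asboolP; exists 0; rewrite mul0r.
rewrite -scalerAl -exprD linearZ /=; case/asboolP: (WX i) => u ->.
by apply/asboolP; exists (r`_i *: u + s); rewrite mulrDl scalerAl.
Qed.

Lemma C_ideal_submod : submod_closed C_ideal.
Proof.
apply: (rep_submod_closed (r := C_rep q f g alpha)).
- by apply/asboolP; exists 0; rewrite mul0r.
- move=> c u v /asboolP[r ->] /asboolP[s ->]; apply/asboolP.
  by exists (c *: r + s); rewrite mulrDl scalerAl.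
- move=> v; apply: C_ideal_ext => i /=; rewrite C_xX; apply/asboolP.
  by exists 'X^(i.+1); rewrite -exprD.
- move=> v; apply: C_ideal_ext => -[|i] /=; rewrite ?add0n ?addSn.
    case: (n) nun => [|m] num; last first.
      by rewrite C_yX num scale0r; apply/asboolP; exists 0; rewrite mul0r.
    by rewrite expr0 C_y0; apply/asboolP; exists 0; rewrite mul0r.
  by rewrite C_yX; apply/asboolP; exists (nu q f g alpha (i + n).+1 *: 'X^i);
    rewrite -scalerAl -exprD.
- move=> v; apply: C_ideal_ext => i /=; rewrite C_hX; apply/asboolP.
  by exists (fiter f alpha (i + n) *: 'X^i); rewrite -scalerAl -exprD.
Qed.
Definition C_submod : submodClosed C_module :=
  HB.pack C_ideal (GRing.isSubmodClosed.Build _ C_module C_ideal C_ideal_submod).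

Definition C_quot : lmodType (Hq q f g) := quot_module C_submod.
End CQ.

Definition exactly_one (P Q R : Prop) : Prop :=
  [/\ [\/ P, Q | R], ~ (P /\ Q), ~ (P /\ R) & ~ (Q /\ R)].

(* Main.v *)
From HB Require Import structures.
Require Import Defs.
From mathcomp Require Import all_boot all_order all_algebra.
From mathcomp Require Import boolp monalg.

Set Implicit Arguments.
Unset Strict Implicit.
Unset Printing Implicit Defensive.

Import Order.TTheory GRing.Theory Num.Theory.
Local Open Scope ring_scope.

(** Let M be a simple module of finite dimension n. The operators h and z = x y
    commute on M, and an invertible T with h T = T f(h) and
    z T = T (q z + g(h)) carries a joint eigenvector of weight (a, b) to one of
    weight (f(a), q b + g(a)). Both T = x, when x is injective, and
    T = y^-1, when y is, satisfy these rules. There are only finitely many joint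
    weights, so the orbit of a weight eventually becomes periodic, and a periodic
    orbit, continued to negative indices, is a pair of functions lam in S_f and
    mu in T_(q, g, lam). If N = |lam| |mu|, then T^N preserves the space of weight
    (lam 0, mu 0), hence has an eigenvector v there, with a nonzero eigenvalue
    gam ([weight_orbit]). Sending t^i to T^i v defines a nonzero homomorphism to M
    from the quotient of type (a) if T = x, of type (b) if T = y^-1. Both sides
    are simple, so it is an isomorphism, and comparing dimensions gives n = N.

    If neither x nor y is injective, then ker y is stable under h and so contains
    an h-eigenvector v, of eigenvalue alpha, and y x^i v = nu_alpha(i) x^(i-1) v.
    Finite dimension forces nu_alpha(m) = 0 for some m >= 1; take the least one.
    The vectors p(x) x^m v form a submodule contained in the image of x, which is
    proper as x is not surjective; so x^m v = 0, and t^i |-> x^i v induces an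
    isomorphism from the quotient of type (c) with m in place of n
    ([exists_type_C]).

    The listed modules are simple for two different reasons. In types (a) and (b)
    the N basis vectors have pairwise distinct weights under (h, z), because lam
    and mu jointly separate residues modulo N ([weights_inj]); hence a nonzero
    submodule contains a basis vector ([separate_weights]), and the invertible
    operator moves it to all the others. In type (c) applying y lowers the degree
    of a polynomial without killing it, until the constant 1 is reached
    ([C_y_reach1]), and 1 generates.

    Finally the types exclude each other, being told apart by the injectivity of
    x and y: x is injective in type (a); y is, but x is not, in type (b); neither
    is in type (c). *)

(** * Modules over the algebra through the operators x, y, h *)

Section HqModules.
Variables (F : fieldType) (q : F) (f g : {poly F}).
Local Notation H := (Hq q f g).
Local Notation X := (Hx q f g).
Local Notation Y := (Hy q f g).
Local Notation h := (Hh q f g).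

(** The words in x, y, h span the algebra, so a property stable under linear
    combinations and left multiplication by the generators holds everywhere. *)
Lemma Hq_ind (P : H -> Prop) :
  P 0 -> (forall c a b, P a -> P b -> P (c *: a + b)) -> P 1 ->
  (forall a, P a -> P (X * a)) -> (forall a, P a -> P (Y * a)) ->
  (forall a, P a -> P (h * a)) -> forall a, P a.
Proof.
move=> P0 PD P1 Px Py Ph a.
have Pw (w : {fmonom 'I_3}) : P (Hpi q f g << w >>).
  have [s ->] : exists s : seq 'I_3, w = \big[mmul/mone]_(i <- s) fmu i.
    exists w; apply: val_inj; case: w => s /=.
    elim: s => [|i s IH]; first by rewrite big_nil fm1.
    by rewrite big_cons [RHS]fmM fmU -IH.
  elim: s => [|i s IH]; first by rewrite big_nil (rmorph1 (Hpi q f g)).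
  rewrite big_cons.
  have -> (u : {fmonom 'I_3}) : << mmul (fmu i) u >> = gen F i * << u >> :> free_alg F.
    by apply/esym; rewrite /gen [LHS]fgmulUU mulr1.
  rewrite rmorphM /=.
  have [->|[->|->]] : i = @Ordinal 3 0 isT \/ i = @Ordinal 3 1 isT \/ i = @Ordinal 3 2 isT.
    by case: i => [[|[|[|//]]]] p; [left|right;left|right;right]; apply: val_inj.
  - exact: Px.
  - exact: Py.
  - exact: Ph.
have -> : a = Hpi q f g (qalg_repr a) by rewrite [RHS]qalg_reprK.
rewrite [qalg_repr a]monalgE.
rewrite linear_sum; elim/big_rec: _ => [|k z _ Pz]; first exact: P0.
have -> : << (qalg_repr a)@_k *g k >> = (qalg_repr a)@_k *: << k >> :> free_alg F.
  by apply/malgP=> j; rewrite mcoeffZ !mcoeffU mulrnAr mulr1.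
rewrite linearZ /=; apply: PD; [exact: Pw | exact: Pz].
Qed.


Section Closed.
Variable M : lmodType H.

(** Submodules as propositions, tested on the scalars and the three generators
    only. *)
Definition hq_closed (S : M -> Prop) : Prop :=
  [/\ S 0,
      forall (c : F) u v, S u -> S v -> S ((c%:A : H) *: u + v),
      forall v, S v -> S (X *: v),
      forall v, S v -> S (Y *: v)
    & forall v, S v -> S (h *: v)].

Lemma hq_closedZ (S : M -> Prop) : hq_closed S ->
  forall (a : H) v, S v -> S (a *: v).
Proof.
case=> S0 SD Sx Sy Sh a v Sv; elim/Hq_ind: a => [|c a b Sa Sb||a|a|a].
- by rewrite scale0r.
- by rewrite scalerDl -mulr_algl -scalerA; apply: SD.
- by rewrite scale1r.
- by rewrite -scalerA; apply: Sx.
- by rewrite -scalerA; apply: Sy.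
- by rewrite -scalerA; apply: Sh.
Qed.

Lemma simple_full (S : M -> Prop) v :
  simple_module M -> hq_closed S -> S v -> v != 0 -> forall u, S u.
Proof.
move=> [_ sM] cS Sv v0.
pose P : {pred M} := fun u => `[< S u >].
have PS : submod_closed P.
  split; first by apply/asboolP; case: cS.
  move=> a u w /asboolP Su /asboolP Sw; apply/asboolP.
  have [_ SD _ _ _] := cS.
  by have := SD 1 _ _ (hq_closedZ cS a Su) Sw; rewrite !scale1r.
pose N : submodClosed M :=
  HB.pack P (GRing.isSubmodClosed.Build _ M P PS).
have [N0|NT u] := sM N.
  by case/eqP: v0; apply: N0; apply/asboolP.
by have /asboolP := NT u.
Qed.
End Closed.

Section Hom.
Variables (M M' : lmodType H) (phi : M -> M').
Hypothesis phiP :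
  forall (c : F) u v, phi ((c%:A : H) *: u + v) = (c%:A : H) *: phi u + phi v.
Hypothesis phi_x : forall v, phi (X *: v) = X *: phi v.
Hypothesis phi_y : forall v, phi (Y *: v) = Y *: phi v.
Hypothesis phi_h : forall v, phi (h *: v) = h *: phi v.

Lemma hq_linear : linear phi.
Proof.
have phi1 u v : phi (u + v) = phi u + phi v.
  by have := phiP 1 u v; rewrite !scale1r.
have phi0 : phi 0 = 0 by apply: (addIr (phi 0)); rewrite -phi1 !add0r.
move=> a u v; rewrite phi1; congr (_ + _).
elim/Hq_ind: a => [|c a b Sa Sb||a IH|a IH|a IH].
- by rewrite !scale0r.
- rewrite !scalerDl -mulr_algl -!scalerA phiP Sa Sb.
  by rewrite scalerA.
- by rewrite !scale1r.
- by rewrite -scalerA phi_x IH scalerA.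
- by rewrite -scalerA phi_y IH scalerA.
- by rewrite -scalerA phi_h IH scalerA.
Qed.
End Hom.

Lemma schur (M M' : lmodType H) (phi : {linear M -> M'}) v :
  simple_module M -> simple_module M' -> phi v != 0 -> bijective phi.
Proof.
move=> sM sM' pv0.
have injphi : injective phi.
  move=> a b ab; apply/eqP; rewrite -subr_eq0; apply/negPn/negP => ab0.
  case/eqP: pv0; apply: (@simple_full M (fun u => phi u = 0) (a - b)) => //.
    split=> [|c u w u0 w0|u u0|u u0|u u0].
    - by rewrite linear0.
    - by rewrite linearP u0 w0 scaler0 addr0.
    - by rewrite linearZ /= u0 scaler0.
    - by rewrite linearZ /= u0 scaler0.
    - by rewrite linearZ /= u0 scaler0.
  by rewrite linearB /= ab subrr.
have surphi : forall u, exists w, phi w = u.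
  apply: (@simple_full M' (fun u => exists w, phi w = u) (phi v)) => //; last by exists v.
  split=> [|c _ _ [u <-] [w <-]|_ [u <-]|_ [u <-]|_ [u <-]].
  - by exists 0; rewrite linear0.
  - by exists (c%:A *: u + w); rewrite linearP.
  - by exists (X *: u); rewrite linearZ.
  - by exists (Y *: u); rewrite linearZ.
  - by exists (h *: u); rewrite linearZ.
exists (fun u => sval (cid (surphi u))) => u; last by case: (cid _).
by apply: injphi; case: (cid _).
Qed.

Section Quot.
Variables (M : lmodType H) (N : submodClosed M).

(** Submodules of M / N are the submodules of M that contain N, so simplicity of
    the quotient can be tested upstairs, on representatives. *)
Lemma simple_quot :
  (exists v, v \notin N) ->
  (forall S : M -> Prop, hq_closed S -> (forall v, v \in N -> S v) ->
     forall w, S w -> w \notin N -> forall v, S v) ->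
  simple_module (quot_module N).
Proof.
move=> [v0 v0N] full; split.
  by exists (qpi N v0); apply: contra v0N => /eqP v00; rewrite -[v0]subr0; apply/qpiP;
    rewrite linear0.
move=> Q; have [[u [Qu u0]]|no] := pselect (exists u, u \in Q /\ u != 0); last first.
  by left=> v Qv; apply/eqP/negPn/negP => v0'; apply: no; exists v.
right=> v; rewrite -(qreprK v).
apply: (full (fun w => qpi N w \in Q) _ _ (qrepr u)).
- split=> [|c a b Qa Qb|a Qa|a Qa|a Qa].
  + by rewrite linear0 rpred0.
  + by rewrite linearP rpredD ?rpredZ.
  + by rewrite linearZ /= rpredZ.
  + by rewrite linearZ /= rpredZ.
  + by rewrite linearZ /= rpredZ.
- move=> w wN; suff -> : qpi N w = 0 by exact: rpred0.
  by rewrite -(linear0 (qpi N)); apply/qpiP; rewrite subr0.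
- by rewrite qreprK.
- by apply: contra u0 => uN; rewrite -(qreprK u) -(linear0 (qpi N)); apply/eqP/qpiP;
    rewrite subr0.
Qed.

Lemma quot_desc (M' : lmodType H) (psi : {linear M -> M'}) :
  (forall v, v \in N -> psi v = 0) ->
  exists phi : {linear quot_module N -> M'}, forall v, phi (qpi N v) = psi v.
Proof.
move=> psi0; pose phi (u : quot_module N) := psi (qrepr u).
have phiE v : phi (qpi N v) = psi v.
  apply/eqP; rewrite -subr_eq0 -linearB; apply/eqP/psi0.
  by apply/qpiP; rewrite qreprK.
have phiP : linear phi.
  by move=> a u v; rewrite -(qreprK u) -(qreprK v) -linearP !phiE linearP.
pose L := GRing.isLinear.Build H (quot_module N) M' _ phi phiP.
by exists (HB.pack phi L : {linear quot_module N -> M'}).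
Qed.
End Quot.

End HqModules.

(** * Finite-dimensional linear algebra over a field *)

Section FiniteDimension.
Variable F : fieldType.

Lemma bij_linear (R : pzRingType) (V W : lmodType R) (phi : {linear V -> W}) :
  bijective phi -> exists psi : {linear W -> V}, cancel phi psi /\ cancel psi phi.
Proof.
case=> psi phiK psiK.
pose L := GRing.isLinear.Build R W V _ psi (can2_linear phiK psiK).
by exists (HB.pack psi L : {linear W -> V}).
Qed.

Lemma isomorphic_sym (R : pzRingType) (V W : lmodType R) :
  isomorphic V W -> isomorphic W V.
Proof. by case=> phi /bij_linear[psi [phiK psiK]]; exists psi, phi. Qed.

Lemma isomorphic_trans (R : pzRingType) (U V W : lmodType R) :
  isomorphic U V -> isomorphic V W -> isomorphic U W.
Proof.
by case=> phi bphi [psi bpsi]; exists (psi \o phi : {linear U -> W}); apply: bij_comp.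
Qed.

Lemma leq_dim_inj n m (phi : {linear 'rV[F]_n -> 'rV[F]_m}) :
  injective phi -> (n <= m)%N.
Proof.
move=> inj; have : row_free (lin1_mx phi).
  apply: inj_row_free => v; rewrite mul_rV_lin1 => pv.
  by apply: inj; rewrite pv linear0.
by move/eqP <-; apply: rank_leq_col.
Qed.

Lemma dim_unique (V : lmodType F) n m :
  isomorphic V 'rV[F]_n -> isomorphic V 'rV[F]_m -> n = m.
Proof.
move=> /isomorphic_sym Vn Vm.
have [phi bphi] := isomorphic_trans Vn Vm.
have [psi [phiK psiK]] := bij_linear bphi.
apply/eqP; rewrite eqn_leq (leq_dim_inj (can_inj phiK)).
exact: leq_dim_inj (can_inj psiK).
Qed.

(** A space of dimension n cannot hold the n + 1 independent vectors that the
    powers 'X^0, ..., 'X^n would give under an injective map. *)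
Lemma poly_map_kernel (V : lmodType F) n (phi : {linear {poly F} -> V}) :
  isomorphic V 'rV[F]_n -> exists2 p, p != 0 & phi p = 0.
Proof.
case=> th bth.
pose G : {linear 'rV[F]_n.+1 -> 'rV[F]_n} := th \o phi \o rVpoly.
have [pk|no] := pselect (exists2 v : 'rV[F]_n.+1, v != 0 & G v = 0); last first.
  have: (n.+1 <= n)%N; last by rewrite ltnn.
  apply: (@leq_dim_inj _ _ G) => a b ab; apply/eqP; rewrite -subr_eq0.
  apply/negPn/negP => ab0; apply: no; exists (a - b) => //.
  by rewrite linearB [X in X - _]ab subrr.
case: pk => v v0 Gv; exists (rVpoly v).
  by apply: contra v0 => /eqP v0; rewrite -[v]rVpolyK v0 linear0.
by apply: (bij_inj bth); rewrite linear0.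
Qed.

Section Operator.
Variables (V : lmodType F) (T : {linear V -> V}).

Lemma pevalE p v : peval p T v = pext (fun i => iter i T v) p.
Proof. by []. Qed.

Lemma pevalD p p' v : peval (p + p') T v = peval p T v + peval p' T v.
Proof. exact: (linearD (pext (fun i => iter i T v))). Qed.

Lemma pevalXn k v : peval 'X^k T v = iter k T v.
Proof. by rewrite pevalE pextX. Qed.

Lemma pevalC c v : peval c%:P T v = c *: v.
Proof.
by rewrite -[c%:P]mulr1 mul_polyC pevalE linearZ /= -pevalE -(expr0 'X) pevalXn.
Qed.

Lemma pevalMX p v : peval (p * 'X) T v = T (peval p T v).
Proof.
rewrite !pevalE.
pose U : {linear {poly F} -> V} := pext (fun i => iter i T v) \o ('X \o* idfun).
pose W : {linear {poly F} -> V} := T \o pext (fun i => iter i T v).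
rewrite -[LHS]/(U p) -[RHS]/(W p); apply: poly_lin_ext => k /=.
by rewrite -exprSr !pextX.
Qed.

Lemma pevalMXsubC p r v :
  peval (p * ('X - r%:P)) T v = T (peval p T v) - r *: peval p T v.
Proof.
rewrite mulrBr [p * _%:P]mulrC mul_polyC !pevalE linearB linearZ /=.
by rewrite -!pevalE pevalMX.
Qed.

Lemma peval_comm (U : {linear V -> V}) p v :
  (forall w, U (T w) = T (U w)) -> U (peval p T v) = peval p T (U v).
Proof.
move=> UT; rewrite linear_sum; apply: eq_bigr => i _.
rewrite linearZ /=; congr (_ *: _).
by elim: (i : nat) => [|k IH] //; rewrite !iterS UT IH.
Qed.

(** Cayley-Hamilton, transported from matrices along a choice of coordinates. *)
Lemma annihilating_poly n : isomorphic V 'rV[F]_n ->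
  exists2 p, p != 0 & forall v, peval p T v = 0.
Proof.
case: n => [|n] [th bth].
  exists 1; rewrite ?oner_eq0 // => v; apply: (bij_inj bth).
  by rewrite [LHS]thinmx0 [RHS]thinmx0.
have [ht [thK htK]] := bij_linear bth.
pose G : {linear 'rV[F]_n.+1 -> 'rV[F]_n.+1} := th \o T \o ht.
pose A := lin1_mx G.
exists (char_poly A); first exact/monic_neq0/char_poly_monic.
move=> v; apply: (bij_inj bth); rewrite [RHS]linear0.
have thE p : th (peval p T v) = th v *m horner_mx A p.
  elim/poly_ind: p => [|p c IH].
    by rewrite pevalE !raddf0.
  rewrite rmorphD rmorphM /= horner_mx_C horner_mx_X mulmxDr mul_mx_scalar.
  rewrite [_ *m (_ * _)]mulmxA -IH mul_rV_lin1 /G /= thK -linearZ -linearD /=.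
  by congr (th _); rewrite -pevalMX pevalD pevalC.
by rewrite thE Cayley_Hamilton mulmx0.
Qed.

Lemma injective_linear_inverse n : isomorphic V 'rV[F]_n -> injective T ->
  exists U : {linear V -> V}, cancel T U /\ cancel U T.
Proof.
move=> [th bth] injT; have [ht [thK htK]] := bij_linear bth.
pose G : {linear 'rV[F]_n -> 'rV[F]_n} := th \o T \o ht.
have Au : lin1_mx G \in unitmx.
  rewrite -row_free_unit; apply: inj_row_free => v; rewrite mul_rV_lin1 => Gv.
  apply: (can_inj htK); apply: injT; apply: (can_inj thK).
  by rewrite !linear0 -[RHS]Gv.
pose U : {linear V -> V} := ht \o mulmxr (invmx (lin1_mx G)) \o th.
exists U; split=> v /=.
  by rewrite -{1}[v]thK -[th (T _)]/(G _) -mul_rV_lin1 mulmxK.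
apply: (can_inj thK).
by rewrite -[LHS]/(G _) -mul_rV_lin1 mulmxKV.
Qed.

End Operator.
End FiniteDimension.

(** In finite dimension, an operator that is onto has a full-rank matrix. *)
Lemma surjective_linear_injective (F : fieldType) (V : lmodType F)
    (T : {linear V -> V}) n :
  isomorphic V 'rV[F]_n -> (forall v, exists u, T u = v) -> injective T.
Proof.
move=> [th bth] surT; have [ht [thK htK]] := bij_linear bth.
pose G : {linear 'rV[F]_n -> 'rV[F]_n} := th \o T \o ht.
have Gfull : row_full (lin1_mx G).
  rewrite -sub1mx; apply/row_subP => i; have [u Tu] := surT (ht (row i 1%:M)).
  suff -> : row i 1%:M = th u *m lin1_mx G by apply: submxMl.
  by rewrite mul_rV_lin1 /G /= thK Tu htK.
have Gu : lin1_mx G \in unitmx by rewrite -row_full_unit.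
move=> a b ab; apply: (can_inj thK); apply: (can_inj (mulmxK Gu)).
by rewrite !mul_rV_lin1 /G /= !thK ab.
Qed.

Section Eigenvectors.
Variables (F : closedFieldType) (V : lmodType F) (T : {linear V -> V}).

(** Strip from p a linear factor 'X - r at a time: the last nonzero vector met
    before reaching p(T) v = 0 is an eigenvector, and it stays in any T-stable
    subspace S that contains v. Choosing for S an eigenspace of an operator that
    commutes with T yields joint eigenvectors. *)
Lemma eigenvector_in (S : V -> Prop) v p :
  (forall c u w, S u -> S w -> S (c *: u + w)) -> (forall u, S u -> S (T u)) ->
  p != 0 -> peval p T v = 0 -> v != 0 -> S v ->
  exists r w, [/\ S w, w != 0 & T w = r *: w].
Proof.
move=> SD ST p0 pv v0 Sv.
have Sp k : S (peval k T v).
  have S0 : S 0 by have := SD (-1) _ _ Sv Sv; rewrite scaleN1r addNr.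
  rewrite /peval; elim/big_rec: _ => [|i x _ Sx] //.
  by apply: SD => //; elim: (i : nat) => [//|j IH]; rewrite iterS; apply: ST.
move: {2}(size p) (leqnn (size p)) => m; elim: m p p0 pv => [|m IH] p p0 pv.
  by rewrite leqn0 size_poly_eq0 (negPf p0).
move=> sp; have [r] : exists r, root p r.
  apply/closed_rootP; apply: contra v0 => /eqP/eqP/size_poly1P[c c0 pc].
  by move/eqP: pv; rewrite pc pevalC scaler_eq0 (negPf c0).
case/factor_theorem => p' pE.
have p'0 : p' != 0 by apply: contra p0 => /eqP p'0; rewrite pE p'0 mul0r.
have [p'v|p'v] := eqVneq (peval p' T v) 0; last first.
  exists r, (peval p' T v); split=> //.
  by apply/eqP; rewrite -subr_eq0 -pevalMXsubC -pE pv.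
by apply: (IH p') => //; move: sp; rewrite pE size_Mmonic ?monicXsubC // size_XsubC addn2.
Qed.

Lemma eigenvalue_root p r w :
  (forall v, peval p T v = 0) -> w != 0 -> T w = r *: w -> root p r.
Proof.
move=> pT w0 Tw; have := pT w; rewrite (peval_eigen p Tw).
by move/eqP; rewrite scaler_eq0 (negPf w0) orbF.
Qed.
End Eigenvectors.

(** * Separating weights, and quotients of representations *)

Lemma int_step_ind (P : int -> Prop) :
  (forall i, P i <-> P (i + 1)) -> forall i j, P i -> P j.
Proof.
move=> st; suff P0 i : P 0 <-> P i by move=> i j /P0 /P0.
elim/int_rect: i => [//|k IH|k IH].
  by rewrite -addn1 PoszD -st.
by rewrite (st (- k.+1%:Z)) -addn1 PoszD opprD addrNK.
Qed.

(** Apply H - a_j or Z - b_j, whichever does not kill u_i, to a combination of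
    weight vectors: the u_j-term disappears, the u_i-term survives up to a nonzero
    factor, and the shorter combination is handled by induction. *)
Lemma separate_weights (F : fieldType) (V : lmodType F) (H Z : {linear V -> V})
    (I : eqType) (s : seq I) (a b : I -> F) (u : I -> V) (S : V -> Prop) :
  (forall c v w, S v -> S w -> S (c *: v + w)) ->
  (forall v, S v -> S (H v)) -> (forall v, S v -> S (Z v)) ->
  (forall i, H (u i) = a i *: u i) -> (forall i, Z (u i) = b i *: u i) ->
  uniq s -> {in s &, forall i j, a i = a j -> b i = b j -> i = j} ->
  forall c : I -> F, S (\sum_(i <- s) c i *: u i) ->
  {in s, forall i, S (c i *: u i)}.
Proof.
move=> SD SH SZ Hu Zu; elim: s => [//|j s IH] /= /andP[js us] inj c.
have SB v w : S v -> S w -> S (v - w).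
  by move=> Sv Sw; rewrite addrC -scaleN1r; apply: SD.
have SK k v : k != 0 -> S (k *: v) -> S v.
  move=> k0 Skv; have := SD k^-1 _ _ Skv (SB _ _ Skv Skv).
  by rewrite scalerA mulVf // scale1r subrr addr0.
have ins i : i \in s -> i \in j :: s by rewrite inE orbC => ->.
have IHs := IH us (fun x y xs ys => inj x y (ins _ xs) (ins _ ys)).
rewrite big_cons; set v := _ *: _; set w := \sum_(i <- s) _ => Svw.
have Ss : {in s, forall i, S (c i *: u i)}.
  move=> i is_.
  have cut (T : {linear V -> V}) (d : I -> F) : (forall x, S x -> S (T x)) ->
      (forall x, T (u x) = d x *: u x) -> d i != d j -> S (c i *: u i).
    move=> ST Tu dij; apply: (@SK (d i - d j)); first by rewrite subr_eq0.
    rewrite scalerA mulrC.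
    (* d j *: (v + w) is reached as (d j - 1) *: (v + w) + (v + w) *)
    apply: (IHs (fun i => c i * (d i - d j)) _ i is_).
    have := SB _ _ (ST _ Svw) (SD (d j - 1) _ _ Svw Svw).
    congr (S _); rewrite -[X in _ - (_ + X)]scale1r -scalerDl subrK.
    rewrite linearD /v linearZ /= Tu scalerDr !scalerA mulrC opprD addrACA subrr add0r.
    rewrite /w linear_sum scaler_sumr -sumrB; apply: eq_bigr => k _.
    by rewrite linearZ /= Tu !scalerA -scalerBl mulrBr [d j * _]mulrC.
  have [aij|aij] := eqVneq (a i) (a j); last exact: (cut H a SH Hu).
  have [bij|bij] := eqVneq (b i) (b j); last exact: (cut Z b SZ Zu).
  have ij : i = j by apply: inj; rewrite ?mem_head ?ins.
  by rewrite -ij is_ in js.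
move=> i; rewrite inE => /orP[/eqP -> |]; last exact: Ss.
have S0 : S 0 by have := SB _ _ Svw Svw; rewrite subrr.
have Sw : S w.
  rewrite /w big_seq; elim/big_rec: _ => // k x ks Sx.
  by have := SD 1 _ _ (Ss k ks) Sx; rewrite scale1r.
by have := SB _ _ Svw Sw; rewrite addrK.
Qed.

Section RepQuotient.
Variables (F : fieldType) (q : F) (f g : {poly F}) (V : lmodType F).
Variables (r : hrep q f g V).

Lemma rep_closed (S : rep_module r -> Prop) : hq_closed S ->
  [/\ S 0, forall (c : F) (u v : V), S u -> S v -> S (c *: u + v),
      forall v : V, S v -> S (opx r v), forall v : V, S v -> S (opy r v)
    & forall v : V, S v -> S (oph r v)].
Proof.
case=> S0 SD Sx Sy Sh; split=> // [c u v Su Sv|v Sv|v Sv|v Sv].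
- by have := SD c _ _ Su Sv; rewrite rep_scale_alg.
- by have := Sx _ Sv; rewrite rep_scale_x.
- by have := Sy _ Sv; rewrite rep_scale_y.
- by have := Sh _ Sv; rewrite rep_scale_h.
Qed.

(** Phi and Psi are coordinates and the corresponding combinations modulo N;
    Phi then identifies the quotient with the space of row vectors. *)
Lemma quot_has_dim (N : submodClosed (rep_module r)) m
    (Phi : {linear V -> 'rV[F]_m}) (Psi : {linear 'rV[F]_m -> V}) :
  (forall v : V, v \in N -> Phi v = 0) ->
  (forall v : V, v - Psi (Phi v) \in N) ->
  cancel Psi Phi -> has_dim (quot_module N) m.
Proof.
move=> PhiN PsiN PsiK.
pose phi (u : restrict_scalars (quot_module N)) : 'rV[F]_m := Phi (qrepr u).
have phiE (v : V) : phi (qpi N v) = Phi v.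
  apply/eqP; rewrite -subr_eq0 -linearB; apply/eqP/PhiN.
  by apply/(qpiP N); rewrite qreprK.
have phiP : linear phi.
  move=> c u v; rewrite -[u](qreprK (N := N)) -[v](qreprK (N := N)).
  have -> : c *: (qpi N (qrepr u) : restrict_scalars _) + qpi N (qrepr v)
    = qpi N (c *: (qrepr u : V) + (qrepr v : V)).
    transitivity (qpi N ((c%:A : Hq q f g) *: qrepr u + qrepr v)).
      by rewrite qpiD qpiZ.
    by rewrite rep_scale_alg.
  by rewrite !phiE linearP.
pose L := GRing.isLinear.Build F _ _ _ phi phiP.
exists (HB.pack phi L : {linear restrict_scalars (quot_module N) -> 'rV[F]_m}).
exists (fun v => qpi N (Psi v)) => /= u; last by rewrite phiE PsiK.
rewrite -[u in RHS](qreprK (N := N)); apply/esym/qpiP; exact: PsiN.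
Qed.
End RepQuotient.

(** * Laurent polynomials modulo a binomial *)

Section LaurentQuotient.
Variables (F : fieldType) (N : nat) (gam : F).
Hypothesis gam0 : gam != 0.
Local Notation t := (@tpow F).
Local Notation I := (laurent_ideal_mem (laurent_binom N gam)).

Lemma laurent_span (S : laurent F -> Prop) :
  S 0 -> (forall (c : F) u v, S u -> S v -> S (c *: u + v)) ->
  (forall i, S (t i)) -> forall v, S v.
Proof.
move=> S0 SD St v; rewrite [v]monalgE; elim/big_rec: _ => [//|k z _ Sz].
have -> : << v@_k *g k >> = v@_k *: t k :> laurent F.
  by apply/malgP=> j; rewrite mcoeffZ !mcoeffU mulrnAr mulr1.
exact: SD.
Qed.

Lemma binom_ideal0 : 0 \in I.
Proof. by apply/asboolP; exists 0; rewrite -/(laurent_mulr _ _) linear0. Qed.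

Lemma binom_idealD (c : F) u v : u \in I -> v \in I -> c *: u + v \in I.
Proof.
move=> /asboolP[r ->] /asboolP[s ->]; apply/asboolP; exists (c *: r + s).
by rewrite -!/(laurent_mulr _ _) linearP.
Qed.

Lemma binom_ideal_scale (c : F) u : c != 0 -> c *: u \in I -> u \in I.
Proof.
move=> c0 /(binom_idealD c^-1)/(_ binom_ideal0).
by rewrite addr0 scalerA mulVf // scale1r.
Qed.

Lemma tpow_period i : t (i + N%:Z) - gam *: t i \in I.
Proof. by apply/asboolP; exists (t i); rewrite tpow_mul_binom. Qed.

Lemma tpow_shift i k : t (i + k * N%:Z) - gam ^ k *: t i \in I.
Proof.
apply: (@int_step_ind (fun k => t (i + k * N%:Z) - gam ^ k *: t i \in I) _ 0) => {k}.
  move=> k; have gamk : gam ^ (k + 1) = gam * gam ^ k.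
    by rewrite expfzDr // expr1z mulrC.
  have e : t (i + (k + 1) * N%:Z) - gam ^ (k + 1) *: t i
      = (t (i + k * N%:Z + N%:Z) - gam *: t (i + k * N%:Z))
        + gam *: (t (i + k * N%:Z) - gam ^ k *: t i).
    by rewrite mulrDl mul1r addrA gamk scalerBr scalerA addrA subrK.
  have p := tpow_period (i + k * N%:Z); rewrite e; split=> kI.
    by rewrite addrC; apply: binom_idealD.
  apply: (binom_ideal_scale gam0).
  by have := binom_idealD (-1) p kI; rewrite scaleN1r addKr.
by rewrite mul0r addr0 expr0z scale1r subrr binom_ideal0.
Qed.

(** The ideal is spanned by the t^i (t^N - gam), so a linear map kills it as
    soon as its values on the powers of t are gam-quasi-periodic. This is the
    way every map out of a quotient of type (a) or (b) is obtained. *)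
Lemma mext_ideal (V : lmodType F) (u : int -> V) :
  (forall i, u (i + N%:Z) = gam *: u i) -> forall v, v \in I -> mext u v = 0.
Proof.
move=> uN v /asboolP[r ->{v}].
move: r; apply: laurent_span => [|c a b a0 b0|i].
- by rewrite -/(laurent_mulr _ _) !linear0.
- by rewrite -/(laurent_mulr _ _) !linearP /= /laurent_mulr a0 b0 scaler0 addr0.
by rewrite tpow_mul_binom linearB linearZ /= !mextU !scale1r uN subrr.
Qed.

(** Coordinates of the quotient in the basis of the classes of
    t^0, ..., t^(N-1): there t^i equals gam^(i div N) t^(i mod N). *)
Definition tcoord : laurent F -> 'rV[F]_N :=
  mext (fun i : int => gam ^ (i %/ N%:Z)%Z *:
    \row_(j < N) ((j%:Z == (i %% N%:Z)%Z)%:R : F)).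
HB.instance Definition _ := GRing.Linear.on tcoord.

Definition tcomb (v : 'rV[F]_N) : laurent F := \sum_(j < N) v 0 j *: t j%:Z.

Lemma tcomb_linear : linear tcomb.
Proof.
move=> c u v; rewrite /tcomb scaler_sumr -big_split /=; apply: eq_bigr => j _.
by rewrite !mxE scalerDl scalerA.
Qed.
HB.instance Definition _ :=
  GRing.isLinear.Build F _ _ _ tcomb tcomb_linear.

Lemma tcoordT i : tcoord (t i) =
  gam ^ (i %/ N%:Z)%Z *: \row_(j < N) ((j%:Z == (i %% N%:Z)%Z)%:R : F).
Proof. by rewrite /tcoord mextU scale1r. Qed.

Lemma tcombK : cancel tcomb tcoord.
Proof.
move=> v; rewrite /tcomb linear_sum; apply/rowP => k; rewrite summxE.
rewrite (bigD1 k) //= big1 => [|j jk]; rewrite linearZ /= tcoordT !mxE.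
  have kN : (k < N)%N := ltn_ord k.
  by rewrite divz_nat divn_small // modz_nat modn_small // eqxx expr0z !mulr1 addr0.
rewrite modz_nat modn_small ?ltn_ord // eqz_nat.
by rewrite eq_sym val_eqE (negPf jk) !mulr0.
Qed.

Hypothesis N0 : (0 < N)%N.
Let Nz : N%:Z != 0. Proof. by rewrite -lt0n. Qed.

Lemma tcoord_ideal v : v \in I -> tcoord v = 0.
Proof.
apply: mext_ideal => i.
have -> : ((i + N%:Z) %/ N%:Z)%Z = 1 + (i %/ N%:Z)%Z.
  by rewrite addrC -{1}[N%:Z]mul1r divzMDl.
by rewrite modzDr expfzDr // expr1z scalerA.
Qed.

Lemma tcoord_mod w : w - tcomb (tcoord w) \in I.
Proof.
move: w; apply: laurent_span => [|c u v Iu Iv|i].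
- by rewrite !linear0 ?addr0 ?subr0 binom_ideal0.
- rewrite !linearP /= addrACA -scalerDr; exact: binom_idealD.
have m0 := modz_ge0 i Nz; have mN : ((i %% N%:Z)%Z < N%:Z) by apply: ltz_pmod.
have -> : tcomb (tcoord (t i)) = gam ^ (i %/ N%:Z)%Z *: t (i %% N%:Z)%Z.
  rewrite tcoordT linearZ /=; congr (_ *: _).
  case: (i %% N%:Z)%Z m0 mN => // k _ kN.
  rewrite /tcomb (bigD1 (Ordinal (kN : (k < N)%N))) //= big1 => [|j jk].
    by rewrite mxE eqxx scale1r addr0.
  by rewrite mxE eqz_nat -[k]/(val (Ordinal (kN : (k < N)%N))) val_eqE (negPf jk) scale0r.
by have := tpow_shift (i %% N%:Z)%Z (i %/ N%:Z)%Z; rewrite [(i %% _)%Z + _]addrC -divz_eq.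
Qed.

Lemma tpow_notin_ideal i : t i \notin I.
Proof.
apply/negP => /tcoord_ideal/rowP; have m0 := modz_ge0 i Nz.
have mN : ((i %% N%:Z)%Z < N%:Z) by apply: ltz_pmod.
rewrite tcoordT; case: (i %% N%:Z)%Z m0 mN => // k _ kN.
move=> /(_ (Ordinal (kN : (k < N)%N))); rewrite !mxE eqxx mulr1.
by apply/eqP; rewrite expfz_neq0.
Qed.

(** Modulo the ideal, t^(i + N) is a nonzero multiple of t^i, so N - 1 steps in
    one direction amount to one step in the other. This lets the same statement
    serve x moving up, in type (a), and y moving down, in type (b). *)
Lemma tpow_all (S : laurent F -> Prop) j :
  S 0 -> (forall (c : F) u v, S u -> S v -> S (c *: u + v)) ->
  (forall v, v \in I -> S v) ->
  (forall i, S (t i) -> S (t (i + 1))) \/ (forall i, S (t i) -> S (t (i - 1))) ->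
  S (t j) -> forall v, S v.
Proof.
have eN : N%:Z = 1 + N.-1%:Z by rewrite -PoszD add1n prednK.
move=> S0 SD SI St Sj; apply: laurent_span => // i.
have SN m k : S (t m) -> S (t (m + k * N%:Z)).
  move=> Sm; have := SD (gam ^ k) _ _ Sm (SI _ (tpow_shift m k)).
  by rewrite addrC subrK.
apply: (@int_step_ind (fun i => S (t i)) _ j) => // {Sj j}i; case: St => St.
  split; first exact: St.
  have Stn n m : S (t m) -> S (t (m + n%:Z)).
    elim: n => [|n IH] Sm; first by rewrite addr0.
    by rewrite -addn1 PoszD addrA; apply/St/IH.
  move/(Stn N.-1)/(SN _ (-1)).
  by rewrite mulN1r eN -[i + 1 + _]addrA addrK.
split=> [Si|/St]; last by rewrite addrK.
have Stn n m : S (t m) -> S (t (m - n%:Z)).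
  elim: n m => [|n IH] m Sm; first by rewrite subr0.
  by rewrite -addn1 PoszD opprD addrA; apply/St/IH.
have := SN _ 1 (Stn N.-1 _ Si).
by rewrite mul1r eN [1 + _]addrC addrA subrK.
Qed.
End LaurentQuotient.

(** * Simplicity and dimension of the quotients of types (a) and (b) *)

Section Period.
Variables (F : fieldType) (q : F) (f g : {poly F}) (lam : Sset f) (mu : Tset q g lam).
Hypothesis q0 : q != 0.

Lemma S_fun_shift (i : int) (k : nat) : lam (i + k%:Z) = iter k (fun u => f.[u]) (lam i).
Proof.
elim: k => [|k IH]; first by rewrite addr0.
by rewrite iterS -IH S_funP -addrA -PoszD addn1.
Qed.

(** From lam i = lam j one gets lam (i + k) = lam (j + k) for k >= 0 only;
    periodicity of lam is what extends it to all integers. *)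
Lemma S_fun_inj (i j : int) : (0 < S_abs lam)%N -> lam i = lam j ->
  (S_abs lam %| j - i)%Z.
Proof.
move=> s0 eij; apply/S_absP => m.
have per k : lam (k + (`|m - i|%N)%:Z * (S_abs lam)%:Z) = lam k.
  by apply/esym; move: k; apply/S_absP; rewrite dvdz_mull ?dvdzz.
(* adding |m - i| periods to m brings it above i *)
have ge0 : 0 <= m - i + (`|m - i|%N)%:Z * (S_abs lam)%:Z.
  apply: (@le_trans _ _ (m - i + (`|m - i|%N)%:Z)); last first.
    by rewrite lerD2l -PoszM lez_nat leq_pmulr.
  by rewrite abszE -lerBlDl sub0r ler_normr lexx orbT.
rewrite -per -[RHS]per.
case E: (m - i + _) ge0 => [k|//] _.
have -> : m + (`|m - i|%N)%:Z * (S_abs lam)%:Z = i + k%:Z.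
  by rewrite -E addrA [i + _]addrC subrK.
have -> : m + (j - i) + (`|m - i|%N)%:Z * (S_abs lam)%:Z = j + k%:Z.
  by rewrite -E !addrA [m + j]addrC.
by rewrite !S_fun_shift eij.
Qed.

(** Equal values of lam differ by a multiple of |lam|; along such a shift the
    recursion of mu is the same and, q being nonzero, reversible, so one equal
    value of mu gives a period of mu and brings in the factor |mu|. *)
Lemma weights_inj (i j : int) : (0 < S_abs lam * T_abs mu)%N ->
  lam i = lam j -> mu i = mu j -> (j = i %[mod (S_abs lam * T_abs mu)%N])%Z.
Proof.
rewrite muln_gt0 => /andP[s0 _] el em; apply/eqP.
rewrite eqz_mod_dvd; have /dvdzP[k kE] := S_fun_inj s0 el.
suff /dvdzP[l lE] : (T_abs mu %| k)%Z.
  by rewrite kE lE; apply/dvdzP; exists l; rewrite -mulrA mulnC PoszM.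
apply/T_absP => //; set s := k * _.
have jE : j = i + s by rewrite /s -kE addrC subrK.
rewrite -[s]add0r.
apply: (@int_step_ind (fun l => mu (l + s) = mu l) _ i); last by rewrite -jE.
move=> l; have lamP : lam l = lam (l + s).
  by move: l; apply/S_absP; rewrite dvdz_mull ?dvdzz.
rewrite addrAC !T_funP -lamP; split=> [->//|/addIr].
by move/(mulfI q0).
Qed.
End Period.

Section AB.
Variables (F : fieldType) (q : F) (f g : {poly F}) (lam : Sset f) (mu : Tset q g lam).
Hypothesis q0 : q != 0.
Variable gam : F.
Hypothesis gam0 : gam != 0.
Local Notation N := (S_abs lam * T_abs mu)%N.
Hypothesis N0 : (0 < N)%N.
Local Notation t := (@tpow F).
Local Notation I := (AB_ideal mu gam).

(** The operator x y, which is the same for both module structures on Laurent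
    polynomials ([A_zE], [B_zE]). *)
Definition AB_z : laurent F -> laurent F := mext (fun i => mu i *: t i).
HB.instance Definition _ := GRing.Linear.on AB_z.

Lemma AB_zT i : AB_z (t i) = mu i *: t i.
Proof. by rewrite /AB_z mextU scale1r. Qed.

Lemma A_zE v : A_x (A_y mu v) = AB_z v.
Proof.
apply: (malg_lin_ext (u := @A_x F \o A_y mu) (v := AB_z)) => i /=.
by rewrite -/(t i) A_yT linearZ /= A_xT subrK AB_zT.
Qed.

Lemma B_zE v : B_x mu (@B_y F v) = AB_z v.
Proof.
apply: (malg_lin_ext (u := B_x mu \o @B_y F) (v := AB_z)) => i /=.
by rewrite -/(t i) B_yT B_xT subrK AB_zT.
Qed.

(** Multiplication by t, which is x in type (a), is inverse to multiplication by
    t^-1, which is y in type (b). *)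
Lemma A_xK : cancel (@A_x F) (@B_y F).
Proof.
apply: (malg_lin_ext (u := @B_y F \o @A_x F) (v := idfun)) => i /=.
by rewrite -/(t i) A_xT B_yT addrK.
Qed.

Lemma B_yK : cancel (@B_y F) (@A_x F).
Proof.
apply: (malg_lin_ext (u := @A_x F \o @B_y F) (v := idfun)) => i /=.
by rewrite -/(t i) B_yT A_xT subrK.
Qed.

(** Representing w by its remainder, some power t^j with 0 <= j < N has a nonzero
    coefficient; as these powers have distinct weights, S contains t^j, and then
    all powers of t. *)
Lemma AB_full (S : laurent F -> Prop) w :
  S 0 -> (forall (c : F) u v, S u -> S v -> S (c *: u + v)) ->
  (forall v, v \in I -> S v) ->
  (forall v, S v -> S (AB_h lam v)) -> (forall v, S v -> S (AB_z v)) ->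
  (forall i, S (t i) -> S (t (i + 1))) \/ (forall i, S (t i) -> S (t (i - 1))) ->
  S w -> w \notin I -> forall v, S v.
Proof.
move=> S0 SD SI Sh Sz St Sw wI.
have Nz : N%:Z != 0 by rewrite -lt0n.
pose c := tcoord N gam w.
have Sc : S (tcomb c).
  have := SD (-1) _ _ (SI _ (tcoord_mod gam0 N0 w)) Sw.
  by rewrite scaleN1r opprB subrK.
have [j cj] : exists j, c 0 j != 0.
  have [//|no] := pselect (exists j, c 0 j != 0).
  case/negP: wI; have := tcoord_mod gam0 N0 w; rewrite -/c /tcomb.
  rewrite big1 ?subr0 // => j _; have [->|cj] := eqVneq (c 0 j) 0.
    by rewrite scale0r.
  by case: no; exists j.
apply: (tpow_all (j := j) gam0 N0) => //.
have := @separate_weights F (laurent F) (AB_h lam) AB_z 'I_N (enum 'I_N)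
  (fun i => lam i) (fun i => mu i) (fun i => t i) S SD Sh Sz
  (fun i => AB_hT lam i) (fun i => AB_zT i) (enum_uniq _).
move=> /(_ _ (fun i => c 0 i)) /=; rewrite big_enum /=.
move=> sep; have Sj : S (c 0 j *: t j%:Z).
  apply: sep => //; last by rewrite mem_enum.
  move=> a b _ _ la ma; have := weights_inj q0 N0 la ma.
  by rewrite !modz_nat !modn_small // => -[] /val_inj.
by have := SD (c 0 j)^-1 _ _ Sj S0; rewrite addr0 scalerA mulVf // scale1r.
Qed.

Lemma A_quot_simple : simple_module (A_quot mu q0 gam).
Proof.
apply: simple_quot; first by exists (t 0); exact: tpow_notin_ideal.
move=> S /rep_closed[S0 SD Sx Sy Sh] SI w Sw wI.
apply: (AB_full (S := S) (w := w)) => // [v Sv|].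
  by rewrite -A_zE; apply: (Sx (A_y mu v)); apply: Sy.
by left=> i Si; rewrite -A_xT; apply: Sx.
Qed.

Lemma B_quot_simple : simple_module (B_quot mu q0 gam).
Proof.
apply: simple_quot; first by exists (t 0); exact: tpow_notin_ideal.
move=> S /rep_closed[S0 SD Sx Sy Sh] SI w Sw wI.
apply: (AB_full (S := S) (w := w)) => // [v Sv|].
  by rewrite -B_zE; apply: (Sx (@B_y F v)); apply: Sy.
by right=> i Si; rewrite -B_yT; apply: Sy.
Qed.

Lemma A_quot_dim : has_dim (A_quot mu q0 gam) N.
Proof.
apply: (quot_has_dim (Phi := tcoord N gam) (Psi := @tcomb F N)).
- exact: tcoord_ideal.
- exact: tcoord_mod.
- exact: tcombK.
Qed.

Lemma B_quot_dim : has_dim (B_quot mu q0 gam) N.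
Proof.
apply: (quot_has_dim (Phi := tcoord N gam) (Psi := @tcomb F N)).
- exact: tcoord_ideal.
- exact: tcoord_mod.
- exact: tcombK.
Qed.

End AB.

(** * Torsion, and the quotients of type (c) *)

Section Torsion.
Variables (F : fieldType) (q : F) (f g : {poly F}).
Local Notation H := (Hq q f g).

Definition torsion_free (a : H) (M : lmodType H) : Prop :=
  forall v : M, a *: v = 0 -> v = 0.

Lemma torsion_free_iso (a : H) (M M' : lmodType H) :
  isomorphic M M' -> torsion_free a M -> torsion_free a M'.
Proof.
case=> phi /bij_linear[psi [phiK psiK]] tM v av0.
apply: (can_inj psiK); rewrite linear0; apply: tM.
by rewrite -linearZ /= av0 linear0.
Qed.

Lemma torsion_free_quot (a : H) (M : lmodType H) (N : submodClosed M) :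
  (forall v : M, a *: v \in N -> v \in N) -> torsion_free a (quot_module N).
Proof.
move=> aN u; rewrite -[u]qreprK -linearZ /= -(linear0 (qpi N)) => /qpiP.
by rewrite subr0 => /aN uN; apply/qpiP; rewrite subr0.
Qed.

Lemma torsion_quot (a : H) (M : lmodType H) (N : submodClosed M) v :
  a *: v \in N -> v \notin N -> ~ torsion_free a (quot_module N).
Proof.
move=> avN vN /(_ (qpi N v)); rewrite -linearZ /=.
have -> : qpi N (a *: v) = 0.
  by rewrite -(linear0 (qpi N)); apply/qpiP; rewrite subr0.
move=> /(_ erefl); rewrite -(linear0 (qpi N)) => /qpiP.
by rewrite subr0 (negPf vN).
Qed.
End Torsion.

Section ABTorsion.
Variables (F : fieldType) (q : F) (f g : {poly F}) (lam : Sset f) (mu : Tset q g lam).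
Hypothesis q0 : q != 0.
Variable gam : F.
Hypothesis gam0 : gam != 0.
Local Notation N := (S_abs lam * T_abs mu)%N.
Hypothesis N0 : (0 < N)%N.
Local Notation t := (@tpow F).

Lemma A_quot_x_free : torsion_free (Hx q f g) (A_quot mu q0 gam).
Proof.
apply: torsion_free_quot => v.
rewrite [Hx q f g *: v]rep_scale_x => xv.
by have := B_ideal_y xv; rewrite /= A_xK.
Qed.

Lemma B_quot_y_free : torsion_free (Hy q f g) (B_quot mu q0 gam).
Proof.
apply: torsion_free_quot => v.
rewrite [Hy q f g *: v]rep_scale_y => yv.
by have := A_ideal_x yv; rewrite /= B_yK.
Qed.

(** x t^(i-1) = mu(i) t^i. *)
Lemma B_quot_x_torsion (i : nat) :
  mu i%:Z = 0 -> ~ torsion_free (Hx q f g) (B_quot mu q0 gam).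
Proof.
move=> mi.
apply: (@torsion_quot _ _ _ _ _ (B_module mu) (B_submod mu q0 gam) (t (i%:Z - 1)));
  last exact: tpow_notin_ideal.
rewrite [Hx q f g *: _]rep_scale_x /= B_xT subrK mi scale0r.
exact: AB_ideal0.
Qed.

(** When mu has no zero, t^i |-> mu(i)^-1 t^(i-1) inverts x and preserves the
    ideal. *)
Lemma B_quot_x_free :
  (forall i : nat, (i < N)%N -> mu i%:Z != 0) ->
  torsion_free (Hx q f g) (B_quot mu q0 gam).
Proof.
move=> mu0; have Nz : N%:Z != 0 by rewrite -lt0n.
have muE k i : mu (i + k * N%:Z) = mu i.
  apply: (@int_step_ind (fun k => mu (i + k * N%:Z) = mu i) _ 0) => {k}.
    by move=> k; rewrite mulrDl mul1r addrA T_period.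
  by rewrite mul0r addr0.
have mui i : mu i != 0.
  have m0 := modz_ge0 i Nz; have mN : ((i %% N%:Z)%Z < N%:Z) by apply: ltz_pmod.
  rewrite (divz_eq i N%:Z) addrC muE.
  by case: (i %% N%:Z)%Z m0 mN => // k _ kN; apply: mu0.
pose W : {linear laurent F -> laurent F} := mext (fun i => (mu i)^-1 *: t (i - 1)).
have WT i : W (t i) = (mu i)^-1 *: t (i - 1) by rewrite /W /= mextU scale1r.
have WK v : W (B_x mu v) = v.
  apply: (malg_lin_ext (u := W \o B_x mu) (v := idfun)) => i /=.
  by rewrite -/(t i) B_xT linearZ WT /= scalerA mulfV // scale1r addrK.
apply: torsion_free_quot => v.
rewrite [Hx q f g *: v]rep_scale_x => xv.
rewrite -(WK v); apply: (wshift_ideal WT _ xv) => i.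
by rewrite T_period.
Qed.
End ABTorsion.

Section CQuot.
Variables (F : fieldType) (q : F) (f g : {poly F}) (alpha : F).
Local Notation nu := (nu q f g alpha).

Lemma C_y_coef (p : {poly F}) k : (C_y q f g alpha p)`_k = nu k.+1 * p`_k.+1.
Proof.
have kn : (k.+1 < maxn (size p) k.+2)%N by rewrite leq_max leqnn orbT.
rewrite /C_y (pextEw _ (leq_maxl _ k.+2)) coef_sum (bigD1 (Ordinal kn)) //=.
rewrite coefZ coefZ coefXn eqxx mulr1 mulrC big1 ?addr0 // => -[[|i] ip] /= ik.
  by rewrite scaler0 coef0.
rewrite !coefZ coefXn; move: ik; rewrite -val_eqE /= eqSS eq_sym => /negPf ->.
by rewrite !mulr0.
Qed.

(** The leading coefficient of y p is nu(deg p) times that of p, so y lowers the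
    degree by exactly one as long as nu does not vanish. *)
Lemma C_y_reach1 (S : {poly F} -> Prop) (p : {poly F}) :
  S 0 -> (forall (c : F) u v, S u -> S v -> S (c *: u + v)) ->
  (forall v, S v -> S (C_y q f g alpha v)) -> S p -> p != 0 ->
  (forall i, (1 <= i < size p)%N -> nu i != 0) -> S 1.
Proof.
move=> S0 SD Sy; move: {2}(size p) (erefl (size p)) => m.
elim: m p => [|m IH] p sp Sp p0 nu0.
  by rewrite -size_poly_eq0 sp in p0.
case: m IH sp => [|m] IH sp.
  move/eqP/size_poly1P: sp => [c c0 pc].
  have := SD c^-1 _ _ Sp S0; rewrite addr0 pc -mul_polyC -polyCM mulVf // polyC1.
have top : (C_y q f g alpha p)`_m != 0.
  rewrite C_y_coef; apply: mulf_neq0; first by apply: nu0; rewrite sp ltnSn.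
  by have := p0; rewrite -lead_coef_eq0 lead_coefE sp.
have syp : size (C_y q f g alpha p) = m.+1.
  apply/eqP; rewrite eqn_leq; apply/andP; split; last first.
    by rewrite ltnNge; apply: contra top => le; rewrite nth_default.
  apply/leq_sizeP => j mj; rewrite C_y_coef nth_default ?mulr0 //.
  by rewrite sp.
apply: (IH (C_y q f g alpha p)) => //.
- exact: Sy.
- by rewrite -size_poly_eq0 syp.
- by move=> i; rewrite syp => /andP[i1 im]; apply: nu0; rewrite i1 sp ltnW.
Qed.

Variable n : nat.
Hypothesis nun : nu n = 0.
Local Notation I := (C_ideal (q := q) (f := f) (g := g) (alpha := alpha) n).

Lemma C_ideal_small (p : {poly F}) : (size p <= n)%N -> p \in I -> p = 0.
Proof.
move=> sp /asboolP[r pE]; have [r0|r0] := eqVneq r 0; first by rewrite pE r0 mul0r.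
move: sp; rewrite pE size_Mmonic ?monicXn // size_polyXn addnS /=.
by rewrite -{2}[n]add0n leq_add2r leqn0 size_poly_eq0 (negPf r0).
Qed.

Lemma C_quot_dim : has_dim (C_quot nun) n.
Proof.
apply: (quot_has_dim (Phi := @poly_rV F n) (Psi := @rVpoly F n)).
- move=> v /asboolP[r ->]; apply/rowP => j; rewrite !mxE coefMXn.
  by rewrite ltn_ord.
- move=> v; apply/asboolP; exists (drop_poly n v).
  suff e : rVpoly (poly_rV v : 'rV_n) = take_poly n v.
    transitivity (v - take_poly n v); first by congr (v - _); exact: e.
    by rewrite -{1}[v](poly_take_drop n) addrC addKr.
  apply/polyP => k; rewrite coef_rVpoly coef_take_poly.
  case: insubP => [j jn <-|]; first by rewrite ltn_ord mxE.
  by move/negPf ->.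
- exact: rVpolyK.
Qed.

Hypothesis n0 : (0 < n)%N.

Lemma C_quot_y_torsion : ~ torsion_free (Hy q f g) (C_quot nun).
Proof.
apply: (@torsion_quot _ _ _ _ _ (C_module q f g alpha) (C_submod nun) (1 : {poly F})).
  rewrite [Hy q f g *: _]rep_scale_y /= C_y0.
  by apply/asboolP; exists 0; rewrite mul0r.
by apply/negP => /C_ideal_small; rewrite size_poly1 => /(_ n0)/eqP; rewrite oner_eq0.
Qed.

Lemma C_quot_x_torsion : ~ torsion_free (Hx q f g) (C_quot nun).
Proof.
apply: (@torsion_quot _ _ _ _ _ (C_module q f g alpha) (C_submod nun)
  ('X^(n.-1) : {poly F})).
  rewrite [Hx q f g *: _]rep_scale_x /= C_xX prednK //.
  by apply/asboolP; exists 1; rewrite mul1r.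
apply/negP => /C_ideal_small; rewrite size_polyXn prednK // => /(_ (leqnn _))/eqP.
by rewrite -size_poly_eq0 size_polyXn.
Qed.

Lemma C_quot_simple :
  (forall i : nat, (1 <= i <= n - 1)%N -> nu i != 0) -> simple_module (C_quot nun).
Proof.
move=> nui; apply: simple_quot.
  exists (1 : {poly F}); apply/negP => /C_ideal_small; rewrite size_poly1.
  by move=> /(_ n0)/eqP; rewrite oner_eq0.
move=> S /rep_closed[S0 SD Sx Sy Sh] SI w Sw wI v.
have Stake : S (take_poly n w).
  have dI : drop_poly n w * 'X^n \in I by apply/asboolP; exists (drop_poly n w).
  have := SD (-1) _ _ (SI _ dI) Sw.
  by rewrite scaleN1r -{2}[w](poly_take_drop n) addrC addrK.
have S1 : S (1 : {poly F}).
  apply: (C_y_reach1 S0 SD Sy Stake).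
    apply: contra wI => /eqP t0; rewrite -[w](poly_take_drop n) t0 add0r.
    by apply/asboolP; exists (drop_poly n w).
  move=> i /andP[i1 it]; apply: nui; rewrite i1 subn1 -ltnS prednK //.
  exact: leq_trans it (size_take_poly _ _).
have SX k : S ('X^k : {poly F}).
  elim: k => [|k IH]; first by rewrite expr0.
  by rewrite -C_xX; apply: Sx.
rewrite -[v : {poly F}]coefK poly_def.
by elim/big_rec: _ => // k z _ Sz; apply: SD.
Qed.
End CQuot.

(** * A module as a representation on its underlying vector space *)

Section Operators.
Variables (F : fieldType) (q : F) (f g : {poly F}).
Local Notation H := (Hq q f g).
Variable M : lmodType H.
Local Notation V := (restrict_scalars M).

(** The action of a as an F-linear operator; it is linear because scalars are
    central in the algebra. *)
Definition hop (a : H) (v : V) : V := a *: (v : M).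

Lemma hop_linear a : linear (hop a).
Proof.
move=> c u v; have rE (w : V) : c *: w = (c%:A : H) *: (w : M) by [].
by rewrite /hop !rE scalerDr !scalerA mulr_algl mulr_algr.
Qed.
HB.instance Definition _ a := GRing.isLinear.Build F V V _ (hop a) (hop_linear a).

Local Notation X := (hop (Hx q f g)).
Local Notation Y := (hop (Hy q f g)).
Local Notation h := (hop (Hh q f g)).

Lemma hop_horner a p v : hop (horner_alg a p) v = peval p (hop a) v.
Proof.
elim/poly_ind: p v => [|p c IH] v.
  by rewrite pevalE /hop !raddf0 scale0r.
rewrite pevalD pevalMX pevalC (@peval_comm _ _ (hop a) (hop a)) // -IH.
rewrite /hop rmorphD rmorphM /= horner_algX horner_algC scalerDl scalerA.
by [].
Qed.
End Operators.

(** * Weight vectors along a periodic orbit *)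

Lemma iter_mod (T : Type) (phi : T -> T) (p : T) (P m : nat) :
  iter P phi p = p -> iter (m %% P) phi p = iter m phi p.
Proof.
move=> pP; rewrite [in RHS](divn_eq m P) addnC iterD; congr (iter _ _ _).
by elim: (m %/ P)%N => [//|k IH]; rewrite mulSn iterD -IH pP.
Qed.

Lemma iter_eventually_periodic (T : eqType) (phi : T -> T) (p : T) (L : seq T) :
  (forall k, iter k phi p \in L) ->
  exists i P, (0 < P)%N /\ iter P phi (iter i phi p) = iter i phi p.
Proof.
move=> pL; have /trajectP[i iL e] : looping phi p (size L).
  apply/negPn; rewrite -looping_uniq; apply/negP => /uniq_leq_size le.
  suff : (size (traject phi p (size L).+1) <= size L)%N.
    by rewrite size_traject ltnn.
  by apply: le => _ /trajectP[k _ ->].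
exists i, (size L - i)%N; rewrite subn_gt0 iL -iterD subnK ?(ltnW iL) //.
Qed.

Section WeightOrbit.
Variables (F : fieldType) (q : F) (f g : {poly F}).
Hypothesis q0 : q != 0.

(** Multiplication by x, or by y^-1, turns a vector of weight p under (h, x y)
    into one of weight wnext p. *)
Definition wnext (p : F * F) : F * F := (f.[p.1], q * p.2 + g.[p.1]).

(** A periodic orbit extends to negative indices by periodicity. Its period P is
    then a period of lam and, measured in units of |lam|, of mu; this is why
    |lam| and |mu| are positive. *)
Lemma periodic_weights (p : F * F) (P : nat) :
  (0 < P)%N -> iter P wnext p = p ->
  exists (lam : Sset f) (mu : Tset q g lam),
    (0 < S_abs lam * T_abs mu)%N /\
    forall k : nat, iter k wnext p = (lam k%:Z, mu k%:Z).
Proof.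
move=> P0 pP; have Pz : P%:Z != 0 by rewrite -lt0n.
pose pt (k : int) := iter `|(k %% P%:Z)%Z| wnext p.
have ptS k : pt (k + 1) = wnext (pt k).
  rewrite /pt -modzDml; have := modz_ge0 k Pz.
  case: (k %% P%:Z)%Z => // m _.
  by rewrite -PoszD modz_nat !absz_nat iter_mod // addn1.
have lamP i : f.[(pt i).1] = (pt (i + 1)).1 by rewrite ptS.
pose lam := MkS lamP.
have muP i : (pt (i + 1)).2 = q * (pt i).2 + g.[lam i] by rewrite ptS.
pose mu := MkT muP; exists lam, mu.
have ptP k : pt (k + P%:Z) = pt k by rewrite /pt modzDr.
have /dvdzP[k Pk] : (S_abs lam %| P%:Z)%Z.
  by apply/S_absP => i /=; rewrite ptP.
split.
  have Tk : (T_abs mu %| k)%Z.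
    by apply/T_absP => //; rewrite -Pk /= -[X in pt X]add0r ptP.
  have := P0; rewrite -[P]/(`|P%:Z|%N) Pk abszM muln_gt0 => /andP[k0 s0].
  by rewrite muln_gt0 s0 (dvdn_gt0 k0).
by move=> m; rewrite -[RHS]surjective_pairing /pt modz_nat absz_nat iter_mod.
Qed.
End WeightOrbit.

Section WeightVectors.
Variables (F : closedFieldType) (q : F) (f g : {poly F}) (q0 : q != 0).
Variables (V : lmodType F) (n : nat) (fin : isomorphic V 'rV[F]_n).
Variables H Z T : {linear V -> V}.
Hypothesis HZ : forall v, H (Z v) = Z (H v).
Hypothesis HT : forall v, H (T v) = T (peval f H v).
Hypothesis ZT : forall v, Z (T v) = T (q *: Z v + peval g H v).
Hypothesis Tinj : injective T.

Definition wvec (p : F * F) (v : V) : Prop := H v = p.1 *: v /\ Z v = p.2 *: v.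

Lemma wvecD p (c : F) u v : wvec p u -> wvec p v -> wvec p (c *: u + v).
Proof.
by case=> Hu Zu [Hv Zv]; rewrite /wvec !linearP /= Hu Zu Hv Zv.
Qed.

Lemma wvecT p v : wvec p v -> wvec (wnext q f g p) (T v).
Proof.
case=> Hv Zv; rewrite /wvec HT ZT (peval_eigen f Hv) (peval_eigen g Hv) Zv.
by rewrite scalerA -scalerDl !linearZ.
Qed.

Lemma wvec_iter p v k : wvec p v -> wvec (iter k (wnext q f g) p) (iter k T v).
Proof. by move=> pv; elim: k => [//|k IH]; rewrite !iterS; apply: wvecT. Qed.

Lemma iterT_neq0 k (v : V) : v != 0 -> iter k T v != 0.
Proof.
move=> v0; elim: k => [//|k IH]; rewrite iterS.
by apply: contra IH => /eqP Tv; apply/eqP/Tinj; rewrite Tv linear0.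
Qed.

Lemma weight_exists (v : V) : v != 0 -> exists p (w : V), w != 0 /\ wvec p w.
Proof.
move=> v0; have [pH pH0 pHv] := annihilating_poly H fin.
have [pZ pZ0 pZv] := annihilating_poly Z fin.
have [//|//|a [w [_ w0 Hw]]] := @eigenvector_in _ _ H (fun=> True) _ _
  _ _ pH0 (pHv v) v0 Logic.I.
have [||b [u [Hu u0 Zu]]] := eigenvector_in (T := Z) (S := fun u => H u = a *: u)
  _ _ pZ0 (pZv w) w0 Hw.
- by move=> c x y Hx Hy; rewrite linearP Hx Hy scalerDr !scalerA mulrC.
- by move=> x Hx; rewrite HZ Hx linearZ.
by exists (a, b), u.
Qed.

(** Weights are pairs of roots of annihilating polynomials. *)
Lemma weights_finite : exists L : seq (F * F),
  forall p (v : V), v != 0 -> wvec p v -> p \in L.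
Proof.
have roots (p : {poly F}) : p != 0 -> exists s : seq F, forall r, root p r -> r \in s.
  move=> p0; have [s ps] := closed_field_poly_normal p; exists s => r.
  by rewrite ps rootZ ?lead_coef_eq0 // root_prod_XsubC.
have [pH pH0 pHv] := annihilating_poly H fin.
have [pZ pZ0 pZv] := annihilating_poly Z fin.
have [[sH sHP] [sZ sZP]] := (roots _ pH0, roots _ pZ0).
exists [seq (a, b) | a <- sH, b <- sZ] => -[a b] v v0 [/= Hv Zv].
apply/allpairsP; exists (a, b); split=> //=.
  by apply: sHP; apply: eigenvalue_root pHv v0 Hv.
by apply: sZP; apply: eigenvalue_root pZv v0 Zv.
Qed.

(** The vector u i plays the role of T^i v; u is extended to the negative integers
    by quasi-periodicity rather than by T^-1, which makes it obvious that u i is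
    a weight vector for i < 0 too. *)
Lemma weight_orbit (v : V) : v != 0 ->
  exists (lam : Sset f) (mu : Tset q g lam) (gam : F) (u : int -> V),
  [/\ (0 < S_abs lam * T_abs mu)%N, gam != 0, u 0 != 0,
     (forall i, T (u i) = u (i + 1)) /\
     (forall i, u (i + (S_abs lam * T_abs mu)%:Z) = gam *: u i)
   & (forall i, H (u i) = lam i *: u i) /\ (forall i, Z (u i) = mu i *: u i)].
Proof.
move=> v0; have [p [w [w0 pw]]] := weight_exists v0.
have [L LP] := weights_finite.
have [i [P [P0 perP]]] : exists i P, (0 < P)%N /\
    iter P (wnext q f g) (iter i (wnext q f g) p) = iter i (wnext q f g) p.
  apply: (@iter_eventually_periodic _ _ _ L) => k.
  exact: LP (iterT_neq0 k w0) (wvec_iter k pw).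
have [lam [mu [N0 lammu]]] := periodic_weights q0 P0 perP.
set N := (S_abs lam * T_abs mu)%N in N0 *; have Nz : N%:Z != 0 by rewrite -lt0n.
have W0 : wvec (lam 0, mu 0) (iter i T w).
  by rewrite -(lammu 0%N); exact: (wvec_iter i pw).
have Wk k x : wvec (lam 0, mu 0) x -> wvec (lam k%:Z, mu k%:Z) (iter k T x).
  by rewrite -(lammu 0%N) -lammu; apply: wvec_iter.
have perl j : lam (j + N%:Z) = lam j by apply: S_period.
have perm j : mu (j + N%:Z) = mu j by apply: T_period.
(* peval 'X^N T is the N-th iterate of T, packaged as a linear map *)
have [r r0 rv] := annihilating_poly (peval 'X^N T) fin.
have [||gam [x [Wx x0 Tx]]] := eigenvector_in (T := peval 'X^N T)
  (S := wvec (lam 0, mu 0)) _ _ r0 (rv _) (iterT_neq0 i w0) W0.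
- exact: wvecD.
- by move=> y /(Wk N); rewrite /= pevalXn -[N%:Z]add0r perl perm.
rewrite /= pevalXn in Tx; exists lam, mu, gam.
exists (fun k : int => gam ^ (k %/ N%:Z)%Z *: iter `|(k %% N%:Z)%Z| T x).
have gam0 : gam != 0.
  apply/negP => /eqP gam0; have := iterT_neq0 N x0.
  by rewrite Tx gam0 scale0r eqxx.
have shift (a : int -> F) k : (forall j, a (j + N%:Z) = a j) ->
    a (`|(k %% N%:Z)%Z|%N%:Z) = a k.
  move=> per; rewrite gez0_abs ?modz_ge0 // [in RHS](divz_eq k N%:Z) addrC.
  apply: (@int_step_ind (fun l => a (k %% N%:Z)%Z = a ((k %% N%:Z)%Z + l * N%:Z)) _ 0).
    by move=> l; rewrite mulrDl mul1r addrA per.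
  by rewrite mul0r addr0.
have Wu k : wvec (lam k, mu k) (gam ^ (k %/ N%:Z)%Z *: iter `|(k %% N%:Z)%Z| T x).
  rewrite -(shift lam k perl) -(shift mu k perm).
  have [Hk Zk] := Wk `|(k %% N%:Z)%Z|%N _ Wx.
  by split; rewrite linearZ /= ?Hk ?Zk /= !scalerA mulrC.
split=> //; first by rewrite div0z mod0z expr0z scale1r.
  split=> k; last first.
    have -> : ((k + N%:Z) %/ N%:Z)%Z = 1 + (k %/ N%:Z)%Z.
      by rewrite addrC -{1}[N%:Z]mul1r divzMDl.
    by rewrite modzDr expfzDr // expr1z scalerA.
  rewrite linearZ /= -iterS.
  have mE := divz_eq k N%:Z; have m0 := modz_ge0 k Nz.
  have mN : ((k %% N%:Z)%Z < N%:Z) by apply: ltz_pmod.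
  move: (k %/ N%:Z)%Z (k %% N%:Z)%Z mE m0 mN => d [m|//] -> _ mN.
  rewrite -addrA -PoszD addn1 divzMDl // modzMDl divz_nat modz_nat !absz_nat.
  have [mN1|] := ltnP m.+1 N.
    by rewrite divn_small // modn_small // addr0.
  move=> Nm; have -> : m.+1 = N by apply/eqP; rewrite eqn_leq Nm andbT.
  by rewrite divnn N0 modnn Tx expfzDr // expr1z scalerA.
by split=> k; have [] := Wu k.
Qed.
End WeightVectors.

(** * Every simple module is of one of the three types *)

Section Comparison.
Variables (F : fieldType) (q : F) (f g : {poly F}).
Local Notation H := (Hq q f g).

Lemma has_dim_iso (M M' : lmodType H) n :
  isomorphic M M' -> has_dim M n -> has_dim M' n.
Proof.
move=> /isomorphic_sym[phi bphi] Mn.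
have phiP : linear (phi : restrict_scalars M' -> restrict_scalars M).
  move=> c u v; rewrite -[c *: u]/((c%:A : H) *: (u : M')).
  exact: (linearP phi c%:A u v).
pose L := GRing.isLinear.Build F (restrict_scalars M') (restrict_scalars M) _ _ phiP.
apply: isomorphic_trans Mn.
by exists (HB.pack (phi : restrict_scalars M' -> restrict_scalars M) L
  : {linear restrict_scalars M' -> restrict_scalars M}).
Qed.

Variables (V : lmodType F) (r : hrep q f g V) (M : lmodType H).
Variable psi : {linear V -> restrict_scalars M}.
Hypothesis psi_x : forall v, psi (opx r v) = hop (Hx q f g) (psi v).
Hypothesis psi_y : forall v, psi (opy r v) = hop (Hy q f g) (psi v).
Hypothesis psi_h : forall v, psi (oph r v) = hop (Hh q f g) (psi v).

Lemma rep_hom_linear : linear (psi : rep_module r -> M).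
Proof.
apply: hq_linear => [c u v|v|v|v].
- by rewrite rep_scale_alg [LHS]linearP.
- by rewrite rep_scale_x psi_x.
- by rewrite rep_scale_y psi_y.
- by rewrite rep_scale_h psi_h.
Qed.

(** By Schur's lemma, a map of representations that kills N and is nonzero
    identifies the simple quotient by N with the simple module M. *)
Lemma isomorphic_quot (N : submodClosed (rep_module r)) (v : V) :
  simple_module M -> simple_module (quot_module N) ->
  (forall w : V, w \in N -> psi w = 0) -> psi v != 0 ->
  isomorphic M (quot_module N).
Proof.
move=> sM sN psiN psiv.
pose L := GRing.isLinear.Build H (rep_module r) M _ _ rep_hom_linear.
pose Psi := HB.pack (psi : rep_module r -> M) L : {linear rep_module r -> M}.
have [phi phiE] := quot_desc (psi := Psi) psiN.
apply: isomorphic_sym; exists phi; apply: (@schur _ _ _ _ _ _ phi (qpi N v)) => //.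
by rewrite phiE.
Qed.
End Comparison.

Lemma C_xE (F : fieldType) (p : {poly F}) : C_x p = p * 'X.
Proof.
pose U : {linear {poly F} -> {poly F}} := 'X \o* idfun.
rewrite -[RHS]/(U p); apply: (poly_lin_ext (u := @C_x F)) => k /=.
by rewrite C_xX exprSr.
Qed.

Section Existence.
Variables (F : closedFieldType) (q : F) (q0 : q != 0) (f g : {poly F}).
Local Notation H := (Hq q f g).
Variables (M : lmodType H) (n : nat).
Hypotheses (sM : simple_module M) (Mn : has_dim M n).
Local Notation V := (restrict_scalars M).
Local Notation X := (hop (Hx q f g) : V -> V).
Local Notation Y := (hop (Hy q f g) : V -> V).
Local Notation h := (hop (Hh q f g) : V -> V).
Local Notation t := (@tpow F).

Lemma hop_hx v : h (X v) = X (peval f h v).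
Proof. by rewrite -hop_horner /hop !scalerA Hrel_hx. Qed.

Lemma hop_yh v : Y (h v) = peval f h (Y v).
Proof. by rewrite -hop_horner /hop !scalerA Hrel_yh. Qed.

Lemma hop_yx v : Y (X v) = q *: X (Y v) + peval g h v.
Proof.
rewrite -hop_horner /hop scalerA.
have -> : Hy q f g * Hx q f g
    = q%:A * (Hx q f g * Hy q f g) + horner_alg (Hh q f g) g.
  by rewrite -Hrel_yx mulr_algl addrC subrK.
by rewrite scalerDl -!scalerA.
Qed.

Lemma hop_h_xy v : h (X (Y v)) = X (Y (h v)).
Proof. by rewrite hop_hx hop_yh. Qed.

Lemma torsion_free_inj a : torsion_free a M -> injective (hop a : V -> V).
Proof.
move=> ta u v uv; apply/eqP; rewrite -subr_eq0; apply/eqP/ta.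
by rewrite scalerBr; apply/eqP; rewrite subr_eq0; apply/eqP.
Qed.

(** Here T = x in [weight_orbit]; y is recovered from y x = q x y + g(h). *)
Lemma exists_type_A : torsion_free (Hx q f g) M ->
  exists (lam : Sset f) (mu : Tset q g lam) (gam : F),
    [/\ gam != 0, n = (S_abs lam * T_abs mu)%N & isomorphic M (A_quot mu q0 gam)].
Proof.
move=> /torsion_free_inj injX; have [[v0 v00] _] := sM.
have [lam [mu [gam [u [N0 gam0 u00 [Tu Nu] [Hu Zu]]]]]] :=
  @weight_orbit F q f g q0 V n Mn h (X \o Y : {linear V -> V}) X
    hop_h_xy hop_hx (fun v => congr1 X (hop_yx v)) injX v0 v00.
have XYu i : X (Y (u i)) = mu i *: u i := Zu i.
pose psi : {linear laurent F -> V} := mext u.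
have psiT i : psi (t i) = u i by rewrite /psi /= mextU scale1r.
have iso : isomorphic M (A_quot mu q0 gam).
  apply: (@isomorphic_quot _ _ _ _ _ (A_rep mu) M psi _ _ _
    (A_submod mu q0 gam) (t 0)) => //.
  - apply: (malg_lin_ext (u := psi \o @A_x F) (v := hop (Hx q f g) \o psi)) => i.
    change (psi (@A_x F (t i)) = hop (Hx q f g) (psi (t i))).
    by rewrite A_xT !psiT Tu.
  - apply: (malg_lin_ext (u := psi \o A_y mu) (v := hop (Hy q f g) \o psi)) => i.
    change (psi (A_y mu (t i)) = hop (Hy q f g) (psi (t i))).
    rewrite A_yT linearZ !psiT.
    have -> : u i = X (u (i - 1)) by rewrite Tu subrK.
    rewrite hop_yx.
    rewrite XYu (peval_eigen g (Hu _)) scalerA -scalerDl -T_funP.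
    by rewrite subrK.
  - apply: (malg_lin_ext (u := psi \o AB_h lam) (v := hop (Hh q f g) \o psi)) => i.
    change (psi (AB_h lam (t i)) = hop (Hh q f g) (psi (t i))).
    by rewrite AB_hT linearZ !psiT Hu.
  - exact: A_quot_simple.
  - exact: mext_ideal.
  - by rewrite psiT.
exists lam, mu, gam; split=> //.
exact: dim_unique (has_dim_iso iso Mn) (A_quot_dim _ _ _).
Qed.

(** Here T = y^-1 in [weight_orbit]. A zero of mu exists because otherwise x would
    be injective ([B_quot_x_free]). *)
Lemma exists_type_B : ~ torsion_free (Hx q f g) M -> torsion_free (Hy q f g) M ->
  exists (lam : Sset f) (mu : Tset q g lam) (gam : F),
    [/\ gam != 0, n = (S_abs lam * T_abs mu)%N,
      exists2 i : nat, (i < S_abs lam * T_abs mu)%N & mu i%:Z = 0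
    & isomorphic M (B_quot mu q0 gam)].
Proof.
move=> ntX /torsion_free_inj injY; have [[v0 v00] _] := sM.
have [U [UK YK]] := injective_linear_inverse Mn injY.
have hU v : h (U v) = U (peval f h v).
  by apply: injY; rewrite hop_yh !YK.
have zU v : X (Y (U v)) = U (q *: X (Y v) + peval g h v).
  by rewrite -hop_yx UK YK.
have [lam [mu [gam [u [N0 gam0 u00 [Tu Nu] [Hu Zu]]]]]] :=
  @weight_orbit F q f g q0 V n Mn h (X \o Y : {linear V -> V}) U
    hop_h_xy hU zU (can_inj YK) v0 v00.
have XYu i : X (Y (u i)) = mu i *: u i := Zu i.
pose psi : {linear laurent F -> V} := mext u.
have psiT i : psi (t i) = u i by rewrite /psi /= mextU scale1r.
have Yu i : Y (u i) = u (i - 1) by rewrite -{1}[i](subrK 1) -Tu YK.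
have iso : isomorphic M (B_quot mu q0 gam).
  apply: (@isomorphic_quot _ _ _ _ _ (B_rep mu) M psi _ _ _
    (B_submod mu q0 gam) (t 0)) => //.
  - apply: (malg_lin_ext (u := psi \o B_x mu) (v := hop (Hx q f g) \o psi)) => i.
    change (psi (B_x mu (t i)) = hop (Hx q f g) (psi (t i))).
    by rewrite B_xT linearZ !psiT /= -XYu Yu addrK.
  - apply: (malg_lin_ext (u := psi \o @B_y F) (v := hop (Hy q f g) \o psi)) => i.
    change (psi (@B_y F (t i)) = hop (Hy q f g) (psi (t i))).
    by rewrite B_yT !psiT Yu.
  - apply: (malg_lin_ext (u := psi \o AB_h lam) (v := hop (Hh q f g) \o psi)) => i.
    change (psi (AB_h lam (t i)) = hop (Hh q f g) (psi (t i))).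
    by rewrite AB_hT linearZ !psiT Hu.
  - exact: B_quot_simple.
  - exact: mext_ideal.
  - by rewrite psiT.
exists lam, mu, gam; split=> //.
  exact: dim_unique (has_dim_iso iso Mn) (B_quot_dim _ _ _).
have [//|no] := pselect (exists2 i : nat, (i < S_abs lam * T_abs mu)%N & mu i%:Z = 0).
case: ntX; apply: (torsion_free_iso (isomorphic_sym iso)).
apply: B_quot_x_free => // i iN; apply/eqP => mi; apply: no.
by exists i.
Qed.

(** The map psi sends 'X^k to x^k v, for an h-eigenvector v killed by y. *)
Lemma exists_type_C : ~ torsion_free (Hx q f g) M -> ~ torsion_free (Hy q f g) M ->
  exists (alpha : F) (nu_n : nu q f g alpha n = 0),
    (forall i : nat, (1 <= i <= n - 1)%N -> nu q f g alpha i != 0) /\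
    isomorphic M (C_quot nu_n).
Proof.
move=> ntX ntY.
have [w [Yw w0]] : exists w : V, Y w = 0 /\ w != 0.
  have [//|no] := pselect (exists w : V, Y w = 0 /\ w != 0).
  case: ntY => w Yw; apply/eqP/negPn/negP => w0; apply: no.
  by exists w.
have [p p0 pw] := annihilating_poly h Mn.
have [||alpha [v [Yv v0 hv]]] := eigenvector_in (T := h) (S := fun v => Y v = 0)
  _ _ p0 (pw w) w0 Yw.
- by move=> c a b Ya Yb; rewrite linearP /= Ya Yb scaler0 addr0.
- by move=> a Ya; rewrite hop_yh Ya linear0.
pose psi : {linear {poly F} -> V} := pext (fun k => iter k X v).
have psiX k : psi 'X^k = iter k X v by rewrite /psi /= pextX.
have psi_x u : psi (C_x u) = X (psi u).
  apply: (poly_lin_ext (u := psi \o @C_x F) (v := hop (Hx q f g) \o psi)) => k.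
  change (psi (@C_x F 'X^k) = hop (Hx q f g) (psi 'X^k)).
  by rewrite C_xX !psiX.
have hk k : h (iter k X v) = fiter f alpha k *: iter k X v.
  elim: k => [//|k IH]; rewrite !iterS hop_hx (peval_eigen f IH) linearZ /=.
  by [].
have psi_h u : psi (C_h f alpha u) = h (psi u).
  apply: (poly_lin_ext (u := psi \o C_h f alpha) (v := hop (Hh q f g) \o psi)) => k.
  change (psi (C_h f alpha 'X^k) = hop (Hh q f g) (psi 'X^k)).
  by rewrite C_hX linearZ !psiX hk.
have Yk k : Y (iter k.+1 X v) = nu q f g alpha k.+1 *: iter k X v.
  elim: k => [|k IH]; rewrite iterS hop_yx (peval_eigen g (hk _)) nuS.
    by rewrite /= Yv linear0 scaler0 add0r nu0 mulr0 add0r.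
  by rewrite IH linearZ /= scalerDl scalerA.
have psi_y u : psi (C_y q f g alpha u) = Y (psi u).
  apply: (poly_lin_ext (u := psi \o C_y q f g alpha) (v := hop (Hy q f g) \o psi)) => k.
  change (psi (C_y q f g alpha 'X^k) = hop (Hy q f g) (psi 'X^k)).
  case: k => [|k]; first by rewrite expr0 C_y0 linear0 -(expr0 'X) psiX.
  by rewrite C_yX linearZ !psiX Yk.
have psi1 : psi 1 = v by rewrite -(expr0 'X) psiX.
(* if nu had no zero, a nonzero polynomial in the kernel of psi could be lowered
   by y to the constant 1, and v = psi 1 would vanish *)
have exm : exists m, (0 < m)%N && (nu q f g alpha m == 0).
  have [//|no] := pselect (exists m, (0 < m)%N && (nu q f g alpha m == 0)).
  have [r r0 psir] := poly_map_kernel psi Mn.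
  case/eqP: v0; rewrite -psi1.
  apply: (C_y_reach1 (q := q) (f := f) (g := g) (alpha := alpha)
    (S := fun u => psi u = 0) (p := r)) => //.
  - by rewrite linear0.
  - by move=> c a b pa pb; rewrite linearP pa pb scaler0 addr0.
  - by move=> a pa; rewrite psi_y pa linear0.
  - by move=> i /andP[i0 _]; apply/negP => nui; apply: no; exists i; rewrite i0.
case: (ex_minnP exm) => m /andP[m0 /eqP num] mmin.
have nui i : (1 <= i <= m - 1)%N -> nu q f g alpha i != 0.
  case/andP=> i0 im; apply/negP => nui; have := mmin i; rewrite i0 nui => /(_ isT).
  by rewrite leqNgt -[m](prednK m0) ltnS -subn1 im.
(* the image of the ideal 'X^m is a submodule; were it nonzero, it would be all of
   M, and x would be surjective *)
have [[z [zI pz]]|kills] := pselect (exists z, z \in C_submod num /\ psi z != 0).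
  pose S (u : M) := exists2 z, z \in C_submod num & psi z = u.
  have [I0 ID Ix Iy Ih] : hq_closed (fun z : C_module q f g alpha => z \in C_submod num).
    split=> [|c a b ca cb|a ca|a ca|a ca]; rewrite ?rpred0 ?rpredZ //.
    by rewrite rpredD ?rpredZ.
  have Sfull : forall u, S u.
    apply: (simple_full (v := psi z)) => //; last by exists z.
    split=> [|c _ _ [a ca <-] [b cb <-]|_ [a ca <-]|_ [a ca <-]|_ [a ca <-]].
    - by exists 0; rewrite ?linear0.
    - exists (c *: a + b); last by rewrite linearP.
      by have := ID c _ _ ca cb; rewrite rep_scale_alg.
    - exists (C_x a); last by rewrite psi_x.
      by have := Ix _ ca; rewrite rep_scale_x.
    - exists (C_y q f g alpha a); last by rewrite psi_y.
      by have := Iy _ ca; rewrite rep_scale_y.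
    - exists (C_h f alpha a); last by rewrite psi_h.
      by have := Ih _ ca; rewrite rep_scale_h.
  have injX : injective X.
    apply: (surjective_linear_injective Mn) => u.
    have [_ /asboolP[r ->] <-] := Sfull u; exists (psi (r * 'X^(m.-1))).
    by rewrite /= -psi_x C_xE -mulrA -exprSr prednK.
  case: ntX => u Xu; apply: injX; rewrite linear0; exact: Xu.
have iso : isomorphic M (C_quot num).
  apply: (@isomorphic_quot _ _ _ _ _ (C_rep q f g alpha) M psi _ _ _
    (C_submod num) 1) => //.
  - exact: C_quot_simple.
  - move=> z zI; apply/eqP/negPn/negP => pz; apply: kills; by exists z.
  - by rewrite psi1.
have mn : n = m := dim_unique (has_dim_iso iso Mn) (C_quot_dim num).
by subst m; exists alpha, num.
Qed.
End Existence.

Theorem theorem3p18 (F : closedFieldType) (q : F) (hq : q != 0)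
    (f g : {poly F}) (n : nat) (hn : (1 <= n)%N) :
  (forall (lam : Sset f) (mu : Tset q g lam) (gam : F),
     gam != 0 -> n = (S_abs lam * T_abs mu)%N ->
     simple_module (A_quot mu hq gam)) /\
  (forall (lam : Sset f) (mu : Tset q g lam) (gam : F),
     gam != 0 -> n = (S_abs lam * T_abs mu)%N ->
     (exists2 i : nat, (i < S_abs lam * T_abs mu)%N & mu i%:Z = 0) ->
     simple_module (B_quot mu hq gam)) /\
  (forall (alpha : F) (nu_n : nu q f g alpha n = 0),
     (forall i : nat, (1 <= i <= n - 1)%N -> nu q f g alpha i != 0) ->
     simple_module (C_quot nu_n)) /\
  (forall M : lmodType (Hq q f g), simple_module M -> has_dim M n ->
     exactly_one
       (exists (lam : Sset f) (mu : Tset q g lam) (gam : F),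
          [/\ gam != 0, n = (S_abs lam * T_abs mu)%N
            & isomorphic M (A_quot mu hq gam)])
       (exists (lam : Sset f) (mu : Tset q g lam) (gam : F),
          [/\ gam != 0, n = (S_abs lam * T_abs mu)%N,
              exists2 i : nat, (i < S_abs lam * T_abs mu)%N & mu i%:Z = 0
            & isomorphic M (B_quot mu hq gam)])
       (exists (alpha : F) (nu_n : nu q f g alpha n = 0),
          (forall i : nat, (1 <= i <= n - 1)%N -> nu q f g alpha i != 0) /\
          isomorphic M (C_quot nu_n))).
Proof.
split=> [lam mu gam gam0 nE|].
  by apply: A_quot_simple => //; rewrite -nE.
split=> [lam mu gam gam0 nE _|].
  by apply: B_quot_simple => //; rewrite -nE.
split=> [alpha nu_n nui|M sM Mn]; first exact: C_quot_simple.
split.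
- have [tX|ntX] := pselect (torsion_free (Hx q f g) M).
    by constructor 1; apply: exists_type_A.
  have [tY|ntY] := pselect (torsion_free (Hy q f g) M).
    by constructor 2; apply: exists_type_B.
  by constructor 3; apply: exists_type_C.
- case=> [[lam [mu [gam [_ _ isoA]]]]].
  case=> [lam' [mu' [gam' [gam0 nE [i _ mi] isoB]]]].
  have := torsion_free_iso (isomorphic_sym isoA) (@A_quot_x_free _ _ _ _ _ _ hq gam).
  move/(torsion_free_iso isoB); apply: (B_quot_x_torsion _ _ mi) => //.
  by rewrite -nE.
- case=> [[lam [mu [gam [_ _ isoA]]]]] [alpha [nun [_ isoC]]].
  have := torsion_free_iso (isomorphic_sym isoA) (@A_quot_x_free _ _ _ _ _ _ hq gam).
  by move/(torsion_free_iso isoC); apply: C_quot_x_torsion.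
- case=> [[lam [mu [gam [_ _ _ isoB]]]]] [alpha [nun [_ isoC]]].
  have := torsion_free_iso (isomorphic_sym isoB) (@B_quot_y_free _ _ _ _ _ _ hq gam).
  by move/(torsion_free_iso isoC); apply: C_quot_y_torsion.
Qed.
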